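(* Let $h:\mathbb R_+\to\mathbb R_+$ denote the entropy of a rate-1 simple random walk on $\mathbb Z$ as a function of time. Suppose $d,N\in\mathbb N$ are such that $1\ll d\lesssim N$. Let $X$ and $Y$ be independent $\mathrm{Multi}_d(N,\mathbf p)$ random variables with uniform parameter $\mathbf p=\frac1d(1,\dots,1)\in\mathbb R^d$. Then the entropy of their difference satisfies $$H(X-Y)=d\cdot h\!\left(\frac{2N}{d}\right)+\begin{cases}\max\{O(dN^{-1/3}),\,O(d(N/d)^{-1/4}),\,O(\log N)\} & \text{if } 1\ll d\ll N,\\ O(N^{2/3}) & \text{if } d\asymp N,\end{cases}$$ where the $O(\cdot)$ terms indicate that the difference can be either positive or negative (i.e. they bound the absolute value of the difference).
   Context: $d$ and $N$ vary along a sequence (with $d\to\infty$): $f\ll g$ means $f/g\to0$, $f\lesssim g$ means $f=O(g)$, $f\asymp g$ means $f=O(g)$ and $g=O(f)$. $H(\cdot)$ is Shannon entropy with natural logarithm, $H(X)=-\sum_x\mathbb P(X=x)\log\mathbb P(X=x)$. $\mathrm{Multi}_d(N,\mathbf p)$ is the multinomial distribution on $\mathbb Z^d$ with $N$ trials and cell probabilities $\mathbf p$: mass $\frac{N!}{\prod_i x_i!}\prod_i p_i^{x_i}$ at $x\in\mathbb Z_{\ge0}^d$ with $\sum_ix_i=N$. $h(s)=H(W_s)$, where $(W_s)_{s\ge0}$ is the continuous-time rate-1 simple random walk on $\mathbb Z$ started at $0$ (jumps at rate 1, each jump $\pm1$ with probability $1/2$). *)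

(* Defs.v *)
From HB Require Import structures.
From mathcomp Require Import all_boot all_order all_algebra.
From mathcomp Require Import ring.
From mathcomp Require Import all_classical all_reals all_analysis.
Set Implicit Arguments.
Unset Strict Implicit.
Unset Printing Implicit Defensive.
Import Order.TTheory GRing.Theory Num.Theory.
Import numFieldNormedType.Exports.
Local Open Scope classical_set_scope.
Local Open Scope ring_scope.

(* Shannon entropy in nats of a probability mass function, valued in \bar R so
   that an infinite entropy is not confused with 0.  Since ln 0 = 0, points of
   mass 0 contribute 0. *)
Definition pmf_entropy (R : realType) (U : choiceType) (p : U -> R) : \bar R :=
  \esum_(x in [set: U]) (- (p x * ln (p x)))%:E.

Section DiscreteRandomVariables.
Context (R : realType) (disp : measure_display) (T : measurableType disp).
Context (P : probability T R).

(* measurability for the discrete sigma-algebra on U *)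
Definition discrete_rv (U : choiceType) (X : T -> U) : Prop :=
  forall A : set U, measurable (X @^-1` A).

Definition rv_pmf (U : choiceType) (X : T -> U) (x : U) : R :=
  fine (P (X @^-1` [set x])).

Definition rv_entropy (U : choiceType) (X : T -> U) : \bar R :=
  pmf_entropy (rv_pmf X).

Definition independent_rv (U V : choiceType) (X : T -> U) (Y : T -> V) : Prop :=
  forall (A : set U) (B : set V),
    P (X @^-1` A `&` Y @^-1` B) = (P (X @^-1` A) * P (Y @^-1` B))%E.

End DiscreteRandomVariables.

Definition multinomial_pmf (R : realType) (d N : nat) (p : 'rV[R]_d)
    (x : 'rV[int]_d) : R :=
  if [forall i, 0 <= x 0 i] && (\sum_i x 0 i == N%:Z) then
    (N`!)%:R / (\prod_i (absz (x 0%R i))`!)%:R * \prod_i p 0 i ^+ absz (x 0 i)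
  else 0.

Definition multinomial_rv (R : realType) (disp : measure_display)
    (T : measurableType disp) (P : probability T R) (d N : nat) (p : 'rV[R]_d)
    (X : T -> 'rV[int]_d) : Prop :=
  discrete_rv X /\ forall x, rv_pmf P X x = multinomial_pmf N p x.

Definition uniform_param (R : realType) (d : nat) : 'rV[R]_d :=
  const_mx (d%:R^-1).

(* P(M = m) for M ~ Poisson(s); unlike the library's [poisson_pmf], this is the
   point mass at 0 when s = 0. *)
Definition jumps_pmf (R : realType) (s : R) (m : nat) : R :=
  expR (- s) * s ^+ m / (m`!)%:R.

(* The m steps are independent uniform signs. *)
Definition walk_pmf (R : realType) (m : nat) (k : int) : R :=
  #|[pred b : {ffun 'I_m -> bool} | \sum_i (-1) ^+ b i == k]|%:R / 2 ^+ m.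

(* The law of W_s for the rate-1 simple random walk W started at 0: the number
   of jumps up to time s is Poisson(s) and independent of the steps.  See
   [srw_processP]. *)
Definition srw_pmf (R : realType) (s : R) (k : int) : R :=
  fine (\sum_(0 <= m <oo) (jumps_pmf s m * walk_pmf R m k)%:E)%E.

(* h(s) = H(W_s), meaningful for s >= 0 *)
Definition srw_entropy (R : realType) (s : R) : \bar R :=
  pmf_entropy (srw_pmf s).

(* W is a rate-1 simple random walk started at 0: it makes the steps
   (-1)^(xi 0), (-1)^(xi 1), .. at the jump times of the rate-1 Poisson
   process J, the signs being independent, uniform and independent of J. *)
Definition srw_process (R : realType) (disp : measure_display)
    (T : measurableType disp) (P : probability T R) (W : R -> T -> int) : Prop :=
  exists (J : R -> T -> nat) (xi : nat -> T -> bool),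
  [/\ (forall t, discrete_rv (J t)) /\ (forall i, discrete_rv (xi i)),
      forall w, J 0 w = 0%N,
      forall (n : nat) (t : nat -> R) (m : nat -> nat),
        0 <= t 0%N -> {homo t : i j / (i <= j)%N >-> i <= j} ->
        P [set w | forall i, (i < n)%N -> J (t i.+1) w = (J (t i) w + m i)%N] =
        (\prod_(i < n) jumps_pmf (t i.+1 - t i) (m i))%:E,
      forall (l n : nat) (t : nat -> R) (m : nat -> nat) (b : nat -> bool),
        (forall i, 0 <= t i) ->
        P ([set w | forall i, (i < l)%N -> J (t i) w = m i] `&`
           [set w | forall i, (i < n)%N -> xi i w = b i]) =
        (P [set w | forall i, (i < l)%N -> J (t i) w = m i] * (2 ^- n)%:E)%E &
      forall (t : R) (w : T), 0 <= t -> W t w = \sum_(i < J t w) (-1) ^+ xi i w].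

Lemma srw_processP (R : realType) (disp : measure_display)
    (T : measurableType disp) (P : probability T R) (W : R -> T -> int) (s : R) :
  srw_process P W -> 0 <= s -> rv_pmf P (W s) =1 srw_pmf s.
Proof.
move=> [J [xi [[mJ mxi] J0 hJ hI hW]]] s0 k; rewrite /rv_pmf /srw_pmf; congr fine.
have PJ m : P (J s @^-1` [set m]) = (jumps_pmf s m)%:E.
  have := hJ 1%N (fun i => if i is 0%N then 0 else s) (fun=> m) (lexx _).
  rewrite big_ord1 subr0 => <- /=; last by case=> [|i] [|j].
  congr (P _); apply/seteqP; split => w /=.
    by move=> Jm [|//] _; rewrite J0 add0n.
  by move=> /(_ 0%N isT); rewrite J0 add0n.
pose C m (b : {ffun 'I_m -> bool}) : set T :=
  J s @^-1` [set m] `&` [set w | forall i : 'I_m, xi i w = b i].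
have mC m b : measurable (@C m b).
  apply: measurableI; first exact: mJ.
  rewrite (_ : [set w | _] = \bigcap_(i in [set: 'I_m]) (xi i @^-1` [set b i])).
    by apply: fin_bigcap_measurable => // i _; exact: mxi.
  by apply/seteqP; split => w /= h => [i _|i]; apply: h.
have PC m b : P (@C m b) = (jumps_pmf s m * 2 ^- m)%:E.
  pose b' i := if insub i is Some j then b j else false.
  have := hI 1%N m (fun=> s) (fun=> m) b' (fun=> s0).
  rewrite (_ : [set w | forall i, (i < 1)%N -> _] = J s @^-1` [set m]); last first.
    by apply/seteqP; split => w /= => [/(_ 0%N isT)|//].
  rewrite PJ -EFinM => <-; congr (P _); apply/seteqP; split => w /= [Jm h]; split => //=.
    by move=> i im; rewrite /b' insubT /=; exact: (h (Ordinal im)).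
  by move=> i; rewrite (h i) // /b' valK.
pose F m : set T := \bigcup_(b in [set b : {ffun 'I_m -> bool} |
  \sum_i (-1) ^+ b i == k]) C m b.
have WF : W s @^-1` [set k] = \bigcup_m F m.
  apply/seteqP; split => w /=.
    rewrite hW // => Wk; exists (J s w) => //.
    exists [ffun i : 'I_(J s w) => xi i w].
      by rewrite /= -Wk; apply/eqP/eq_bigr => i _; rewrite ffunE.
    by split => // i /=; rewrite ffunE.
  move=> [m _ [b /= /eqP bk [/= Jm xb]]].
  rewrite hW // Jm -bk; apply: eq_bigr => i _; by rewrite xb.
have mF m : measurable (F m) by apply: fin_bigcup_measurable.
rewrite WF measure_bigcup//; last first.
  move=> m1 m2 _ _ [w [[b1 _ [/= e1 _]] [b2 _ [/= e2 _]]]].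
  by rewrite -e1 -e2.
rewrite (eq_eseriesl (Q := xpredT)); last by move=> m; rewrite in_setT.
apply: eq_eseriesr => m _; rewrite measure_fin_bigcup //; first last.
  move=> b1 b2 _ _ [w [[_ /= e1] [_ /= e2]]].
  by apply/ffunP => i; rewrite -e1 -e2.
- exact: finite_finset.
transitivity (\sum_(b : {ffun 'I_m -> bool} |
  (\sum_i (-1) ^+ b i == k)%R) P (C m b))%E.
  symmetry; apply: bigfs; first exact: index_enum_uniq.
  by move=> b _; rewrite mem_index_enum.
under eq_bigr do rewrite PC.
rewrite sumEFin sumr_const /walk_pmf -mulrnAl -mulr_natr -mulrA.
by congr (_%:E); ring.
Qed.

(* Main.v *)
(* Write X_m, Y_m for independent uniform multinomials with m trials and let
   K, L be independent Poisson(N).  By Poissonization X_K - Y_L is a vector of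
   d independent rate-1 walks at time 2N/d, so d h(2N/d) = H(X_K - Y_L), and
   conditioning on K and L,
     E H(X_K - Y_L | K, L) <= d h(2N/d) <= E H(X_K - Y_L | K, L) + H(K) + H(L)
   with H(K) = O(ln N).  Throwing one more ball shows that H(X_k - Y_l) is
   nondecreasing and concave in k and in l (submodularity of the entropy of
   sums); a nonnegative nondecreasing concave f satisfies
   |f(k) - f(N)| <= |k - N| / N * f(N), and E|K - N| <= sqrt N, so replacing K and L
   by N costs O(N^(-1/2)) H(X_N - Y_N).  Since X_N - Y_N has entries in [-N, N],
   H(X_N - Y_N) <= d ln(2N + 1), and the total error is
   O(d N^(-1/2) ln N + ln N) = O(d N^(-1/3) + ln N), within both bounds. *)
Require Import Defs.
From mathcomp Require Import all_boot all_order all_algebra.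
From mathcomp Require Import ring lra zify.
From mathcomp Require Import all_classical all_reals all_analysis.
Set Implicit Arguments.
Unset Strict Implicit.
Unset Printing Implicit Defensive.
Import Order.TTheory GRing.Theory Num.Theory.
Import numFieldNormedType.Exports.
Local Open Scope classical_set_scope.
Local Open Scope ring_scope.

(** * Unconditional sums and the entropy function *)

(** Entropies are unconditional sums in the extended reals, so terms cannot be moved by subtraction
    before finiteness is known. Inequalities are therefore arranged with nonnegative terms on both
    sides, proved at each point [x], and only then summed. The work is done on mass functions rather
    than on random variables: one ball is the operator [avg v], which averages the translates of a
    law by the vectors [v i], and the law of X_m - Y_n arises from a point mass by m averagings
    along the unit vectors and n along their negatives. Since all averagings commute, the trials of
    X and of Y can be Poissonized one at a time, starting from an arbitrary law of finite entropy,
    and concavity is only needed in one count at a time. The price is an intermediate entropy, whose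
    size must itself be controlled by H(X_N - Y_N). The exponent 1/3 leaves a factor N^(1/6) of room
    against the N^(-1/2) obtained; this room absorbs the logarithm. *)

Section Esum.
Context {R : realType}.
Local Open Scope ereal_scope.

Lemma ge0_esumZl (T : choiceType) (c : R) (a : T -> \bar R) :
  (0 <= c)%R -> (forall x, 0 <= a x) ->
  \esum_(x in setT) (c%:E * a x) = c%:E * \esum_(x in setT) a x.
Proof.
move=> c0 a0; rewrite le_eqVlt in c0; case/orP: c0 => [/eqP <-|c0].
  by rewrite mul0e esum1 // => x _; rewrite mul0e.
have fsZ (k : R) (A : set T) : (0 < k)%R ->
    \sum_(x \in A) (k%:E * a x) = k%:E * \sum_(x \in A) a x.
  by move=> k0; rewrite ge0_mule_fsumr.
apply/eqP; rewrite eq_le; apply/andP; split.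
  apply: ge_ereal_sup => _ [A [finA _] <-]; rewrite fsZ //.
  by apply: lee_wpmul2l; [rewrite lee_fin ltW|apply: esum_ge; exists A].
rewrite -lee_pdivlMl //; apply: ge_ereal_sup => _ [A [finA _] <-].
by rewrite lee_pdivlMl // -fsZ //; apply: esum_ge; exists A.
Qed.

Lemma le_esum_term (T : choiceType) (a : T -> \bar R) x :
  (forall x, 0 <= a x) -> a x <= \esum_(x in setT) a x.
Proof.
move=> a0; apply: esum_ge; exists [set x] => //.
by rewrite fsbig_set1.
Qed.

(** The constant may be [+oo]: it will be an entropy not yet known to be finite. *)
Lemma ge0_esumZr (T : choiceType) (f : T -> R) (C : \bar R) :
  (forall x, (0 <= f x)%R) -> 0 <= C ->
  \esum_(x in setT) ((f x)%:E * C) = (\esum_(x in setT) (f x)%:E) * C.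
Proof.
move=> f0; case: C => [c| |//] c0.
  rewrite muleC -ge0_esumZl //; apply: eq_esum => x _; exact: muleC.
have [[x fx]|f00] := pselect (exists x, (0 < f x)%R).
  rewrite gt0_muley; last first.
    by apply: lt_le_trans (le_esum_term x _); rewrite ?lte_fin.
  apply/eqP; rewrite eq_le leey /=.
  apply: le_trans (le_esum_term x _); first by rewrite gt0_muley.
  by move=> y; rewrite mule_ge0 // lee_fin.
have f_0 x : f x = 0%R.
  apply/eqP; rewrite eq_le f0 andbT leNgt; apply/negP => fx.
  by apply: f00; exists x.
by rewrite !esum1 ?mul0e // => x _; rewrite f_0 ?mul0e.
Qed.

Lemma esum_pair (T U : choiceType) (a : T -> U -> \bar R) :
  (forall x y, 0 <= a x y) ->
  \esum_(x in setT) \esum_(y in setT) a x y = \esum_(k in setT) a k.1 k.2.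
Proof.
move=> a0; rewrite esum_esum //; congr esum.
by apply/seteqP; split.
Qed.

Lemma esum_bij (T U : choiceType) (e : T -> U) (a : U -> \bar R) :
  bijective e -> \esum_(y in setT) a y = \esum_(x in setT) a (e x).
Proof.
move=> eb; apply: reindex_esum; split=> //; first by move=> x y _ _; exact: bij_inj.
by case: eb => g eg ge y _; exists (g y).
Qed.

Lemma esum_swap (T U : choiceType) (a : T -> U -> \bar R) :
  (forall x y, 0 <= a x y) ->
  \esum_(x in setT) \esum_(y in setT) a x y =
  \esum_(y in setT) \esum_(x in setT) a x y.
Proof.
move=> a0; rewrite !esum_pair //.
apply: (@esum_bij _ _ (fun k : U * T => (k.2, k.1))).
by exists (fun k : T * U => (k.2, k.1)) => -[].
Qed.

Lemma esum_single (T : choiceType) (x0 : T) (a : T -> \bar R) :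
  0 <= a x0 -> (forall x, x != x0 -> a x = 0) -> \esum_(x in setT) a x = a x0.
Proof.
move=> a0 ax; rewrite -[RHS]esum_set1 // [RHS]esum_mkcond.
apply: eq_esum => x _; rewrite in_set1.
by case: (eqVneq x x0) => [->|/ax].
Qed.

Lemma esum_nat_recl (a : nat -> \bar R) : (forall k, 0 <= a k) ->
  \esum_(k in setT) a k = a 0%N + \esum_(k in setT) a k.+1.
Proof.
move=> a0; rewrite (esumID [set 0%N]) // !setTI esum_set1 //; congr (_ + _).
apply: (@reindex_esum _ _ _ setT (~` [set 0%N]) S); split => //.
  by move=> x y _ _ [].
by case=> [/(_ erefl)//|k] _; exists k.
Qed.

Lemma esum_shift (V : zmodType) (v : V) (a : V -> \bar R) :
  \esum_(x in setT) a (x - v)%R = \esum_(x in setT) a x.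
Proof.
symmetry; apply: esum_bij.
by exists (fun x => x + v)%R => x; rewrite ?subrK ?addrK.
Qed.

End Esum.

(** * The function - t ln t *)

Section Eta.
Context {R : realType}.
Implicit Types t q a b : R.

Definition eta t : R := - (t * ln t).

Lemma eta0 : eta 0 = 0. Proof. by rewrite /eta mul0r oppr0. Qed.

Lemma eta_ge0 t : 0 <= t -> t <= 1 -> 0 <= eta t.
Proof. by move=> t0 t1; rewrite oppr_ge0 mulr_ge0_le0 // ln_le0. Qed.

(** This Leibniz rule is the source of the chain rule for mixtures and of the additivity of entropy
    over independent coordinates. *)
Lemma etaM a b : 0 <= a -> 0 <= b -> eta (a * b) = eta a * b + a * eta b.
Proof.
rewrite le_eqVlt => /orP[/eqP <-|a0]; first by rewrite !(mul0r, eta0) addr0.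
rewrite le_eqVlt => /orP[/eqP <-|b0]; first by rewrite !(mulr0, eta0) addr0.
by rewrite /eta lnM ?posrE //; ring.
Qed.

(* The tangent line to the concave [eta] at [q]; it is [ln x <= x - 1] at [x = q / t]. *)
Lemma eta_tangent t q : 0 <= t -> 0 <= q -> (q = 0 -> t = 0) ->
  eta t + t <= t * - ln q + q.
Proof.
move=> t0; rewrite le_eqVlt => /orP[/eqP <- /(_ erefl) ->|q0 _].
  by rewrite eta0 mul0r.
move: t0; rewrite le_eqVlt => /orP[/eqP <-|t0].
  by rewrite eta0 mul0r !add0r ltW.
have := ler_wpM2l (ltW t0) (le_ln1Dx (x := q / t - 1) _).
rewrite addrCA subrr addr0 ltrBDr addNr divr_gt0 // => /(_ isT).
rewrite ln_div ?posrE // /eta mulrBr mulrBr mulr1 mulrCA divff ?gt_eqF //.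
by rewrite mulr1; lra.
Qed.

End Eta.

(** * Entropy of mixtures and of averages of translates *)

Section Mixtures.
Context {R : realType}.
Implicit Types U K : choiceType.

Definition is_pmf U (p : U -> R) : Prop :=
  (forall x, 0 <= p x) /\ \esum_(x in setT) (p x)%:E = 1%E.

Lemma pmf_le1 U (p : U -> R) x : is_pmf p -> p x <= 1.
Proof. by move=> [p0 p1]; rewrite -lee_fin -p1 le_esum_term. Qed.

Lemma pmf_eta_ge0 U (p : U -> R) x : is_pmf p -> 0 <= eta (p x).
Proof. by move=> pp; rewrite eta_ge0 ?pmf_le1 //; case: pp. Qed.

Lemma pmf_entropy_ge0 U (p : U -> R) : is_pmf p -> (0 <= pmf_entropy p)%E.
Proof. by move=> pp; apply: esum_ge0 => x _; rewrite lee_fin pmf_eta_ge0. Qed.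

Section Mixture.
Variables (U K : choiceType) (w : K -> R) (g : K -> U -> R) (q : U -> R).
Hypotheses (wp : is_pmf w) (gp : forall k, is_pmf (g k)).
Hypothesis qE : forall x, (q x)%:E = \esum_(k in setT) (w k * g k x)%:E.

Let w0 k : 0 <= w k. Proof. by case: wp. Qed.
Let g0 k x : 0 <= g k x. Proof. by case: (gp k). Qed.

Lemma mixture_pmf : is_pmf q.
Proof.
split=> [x|]; first by rewrite -lee_fin qE esum_ge0 // => k _; rewrite lee_fin mulr_ge0.
under eq_esum do rewrite qE.
rewrite esum_swap => [|x k]; last by rewrite lee_fin mulr_ge0.
case: wp => _ <-; apply: eq_esum => k _.
under eq_esum do rewrite EFinM.
rewrite ge0_esumZl // => [|x]; last by rewrite lee_fin.
by case: (gp k) => _ ->; rewrite mule1.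
Qed.

Let mixture_comp k x : w k * g k x <= q x.
Proof.
rewrite -lee_fin qE (@le_esum_term _ _ (fun k => (w k * g k x)%:E)) // => j.
by rewrite lee_fin mulr_ge0.
Qed.

(** Conditioning reduces entropy: at each [x] the concave [eta] lies below its tangent at the mean
    [q x], and averaging over the values [g k x] with weights [w k] cancels the linear term. *)
Lemma mixture_entropy_ge :
  (\esum_(k in setT) ((w k)%:E * pmf_entropy (g k)) <= pmf_entropy q)%E.
Proof.
have qp := mixture_pmf.
have e0 k x : (0 <= (w k * eta (g k x))%:E)%E.
  by rewrite lee_fin mulr_ge0 ?pmf_eta_ge0.
have -> : (\esum_(k in setT) ((w k)%:E * pmf_entropy (g k)) =
    \esum_(x in setT) \esum_(k in setT) (w k * eta (g k x))%:E)%E.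
  rewrite esum_swap //; apply: eq_esum => k _.
  rewrite /pmf_entropy -ge0_esumZl // => x; by rewrite lee_fin pmf_eta_ge0.
apply: le_esum => x _.
have q0 : 0 <= q x by case: qp.
have lq0 : 0 <= - ln (q x) by rewrite oppr_ge0 ln_le0 // pmf_le1.
(* Adding the finite [q x] to both sides leaves a tangent inequality with nonnegative terms only, so
   that the sum over [k] may be split. *)
rewrite -(@leeD2rE _ (q x)%:E) // {1}qE -esumD //; last first.
  by move=> k _; rewrite lee_fin mulr_ge0.
apply: (@le_trans _ _ (\esum_(k in setT)
    ((- ln (q x))%:E * (w k * g k x)%:E + (q x)%:E * (w k)%:E))%E).
  apply: le_esum => k _; rewrite -!EFinM -!EFinD lee_fin.
  rewrite -mulrDr; have := w0 k; rewrite le_eqVlt => /orP[/eqP <-|wk].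
    by rewrite !(mul0r, mulr0) addr0.
  rewrite mulrCA (mulrC (q x)) -mulrDr ler_pM2l // mulrC.
  apply: eta_tangent => // qx0.
  have := mixture_comp k x; rewrite qx0 pmulr_rle0 // => gx.
  by apply/eqP; rewrite eq_le gx g0.
rewrite esumD; first last.
- by move=> k _; rewrite -EFinM lee_fin mulr_ge0.
- by move=> k _; rewrite -EFinM lee_fin mulr_ge0 // mulr_ge0.
rewrite !ge0_esumZl //; last by move=> k; rewrite lee_fin mulr_ge0.
case: wp => _ ->; rewrite -qE mule1 -EFinM leeD2r // lee_fin.
by rewrite mulNr mulrC.
Qed.

(** The joint law of component and value has masses [w k * g k x], each at most [q x]. Replacing
    [- ln (q x)] by [- ln (w k * g k x)] therefore bounds the entropy of [q] by the joint entropy,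
    which [etaM] splits by the chain rule. *)
Lemma mixture_entropy_le :
  (pmf_entropy q <=
   \esum_(k in setT) ((w k)%:E * pmf_entropy (g k)) + pmf_entropy w)%E.
Proof.
have qp := mixture_pmf.
have wg1 k x : w k * g k x <= 1 by rewrite mulr_ile1 // pmf_le1.
have e0 k x : (0 <= (eta (w k * g k x))%:E)%E.
  by rewrite lee_fin eta_ge0 // mulr_ge0.
apply: (@le_trans _ _ (\esum_(x in setT) \esum_(k in setT)
    (eta (w k * g k x))%:E)%E).
  apply: le_esum => x _.
  have lq0 : 0 <= - ln (q x) by rewrite oppr_ge0 ln_le0 // pmf_le1.
  rewrite -mulrN mulrC EFinM qE -ge0_esumZl // => [|k]; last first.
    by rewrite lee_fin mulr_ge0.
  apply: le_esum => k _; rewrite -EFinM lee_fin /eta -mulrN mulrC.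
  have := mulr_ge0 (w0 k) (g0 k x); rewrite le_eqVlt => /orP[/eqP <-|wg].
    by rewrite !mul0r.
  have qx := lt_le_trans wg (mixture_comp k x).
  by rewrite ler_pM2l // lerN2 ler_ln ?posrE // mixture_comp.
rewrite esum_swap // -esumD; first last.
- by move=> k _; rewrite lee_fin pmf_eta_ge0.
- by move=> k _; rewrite mule_ge0 ?lee_fin ?pmf_entropy_ge0.
apply: le_esum => k _.
rewrite (eq_esum (b := fun x => ((w k)%:E * (eta (g k x))%:E +
   (eta (w k))%:E * (g k x)%:E)%E)); last first.
  by move=> x _; rewrite etaM // addrC.
rewrite esumD; first last.
- by move=> x _; rewrite -EFinM lee_fin mulr_ge0 // pmf_eta_ge0.
- by move=> x _; rewrite -EFinM lee_fin mulr_ge0 // pmf_eta_ge0.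
rewrite !ge0_esumZl ?pmf_eta_ge0 // => [||x].
- by case: (gp k) => _ ->; rewrite mule1.
- by move=> x; rewrite lee_fin.
- by rewrite lee_fin pmf_eta_ge0.
Qed.

End Mixture.

Lemma esum_finType (T : finType) (a : T -> \bar R) : (forall x, 0 <= a x)%E ->
  \esum_(x in setT) a x = (\sum_x a x)%E.
Proof.
move=> a0; rewrite esum_fset //.
rewrite -set_true -(@bigfs _ _ _ _ (index_enum T)) ?index_enum_uniq //.
- by move=> x; rewrite mem_index_enum.
- exact: finite_finset.
Qed.

Lemma uniform_pmf d : (0 < d)%N -> is_pmf (fun _ : 'I_d => d%:R^-1 : R).
Proof.
move=> d0; split=> [_|]; first by rewrite invr_ge0.
rewrite esum_finType => [|_]; last by rewrite lee_fin invr_ge0.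
by rewrite sumEFin sumr_const card_ord -[_ *+ _]mulr_natl divff // pnatr_eq0 -lt0n.
Qed.

Lemma uniform_entropy d : (0 < d)%N ->
  pmf_entropy (fun _ : 'I_d => d%:R^-1 : R) = (ln d%:R)%:E.
Proof.
move=> d0; rewrite /pmf_entropy esum_finType => [|i]; last first.
  rewrite lee_fin; exact: (pmf_eta_ge0 i (uniform_pmf d0)).
rewrite sumEFin sumr_const card_ord -[_ *+ _]mulr_natl.
have dn0 : d%:R != 0 :> R by rewrite pnatr_eq0 -lt0n.
by rewrite lnV ?posrE ?ltr0n //; congr EFin; field.
Qed.

End Mixtures.

(** * Throwing one more ball: monotonicity and concavity of the entropy *)

Section Averages.
Context {R : realType} {V : zmodType} {d : nat}.
Implicit Types (v u : 'I_d -> V) (p : V -> R).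

(* The law of X + v_I for X of law p and I uniform, independent of X. *)
Definition avg v p (x : V) : R := d%:R^-1 * \sum_i p (x - v i).

Lemma avg_ge0 v p : (forall x, 0 <= p x) -> forall x, 0 <= avg v p x.
Proof. by move=> p0 x; rewrite mulr_ge0 ?invr_ge0 // sumr_ge0. Qed.

Lemma avg_mixture v p x : (forall x, 0 <= p x) ->
  (avg v p x)%:E = \esum_(i in setT) (d%:R^-1 * p (x - v i))%:E.
Proof.
move=> p0; rewrite esum_finType => [|i]; last by rewrite lee_fin mulr_ge0 ?invr_ge0.
by rewrite sumEFin /avg mulr_sumr.
Qed.

Lemma avgC u v p : avg u (avg v p) =1 avg v (avg u p).
Proof.
move=> x; rewrite /avg -!mulr_sumr exchange_big /=; congr (_ * (_ * _)).
by apply: eq_bigr => i _; apply: eq_bigr => j _; rewrite addrAC.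
Qed.

Hypothesis d0 : (0 < d)%N.

(** All translates have the same sum. Besides preserving total mass, this is applied to [eta \o p],
    which allows entropies of different laws to be compared point by point. *)
Lemma esum_avg v p : (forall x, 0 <= p x) ->
  \esum_(x in setT) (avg v p x)%:E = \esum_(x in setT) (p x)%:E.
Proof.
move=> p0; under eq_esum do rewrite avg_mixture //.
rewrite esum_swap => [|x i]; last by rewrite lee_fin mulr_ge0 ?invr_ge0.
under eq_esum => i _.
  under eq_esum do rewrite EFinM.
  rewrite ge0_esumZl ?invr_ge0 // => [|x]; last by rewrite lee_fin.
  rewrite (@esum_shift _ _ _ (EFin \o p)) /=; over.
rewrite ge0_esumZr ?esum_ge0 // => [|x _]; last by rewrite lee_fin.
by have [_ ->] := uniform_pmf (R := R) d0; rewrite mul1e.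
Qed.

Lemma shift_pmf (y : V) p : is_pmf p -> is_pmf (fun x => p (x - y)).
Proof. by move=> [p0 p1]; split=> //; rewrite (@esum_shift _ _ _ (EFin \o p)). Qed.

Lemma shift_entropy (y : V) p : pmf_entropy (fun x => p (x - y)) = pmf_entropy p.
Proof. exact: (@esum_shift _ _ _ (fun x => (- (p x * ln (p x)))%:E)). Qed.

Lemma avg_pmf v p : is_pmf p -> is_pmf (avg v p).
Proof.
by move=> [p0 p1]; split; [exact: avg_ge0|rewrite esum_avg].
Qed.

Lemma avg_entropy_ge v p : is_pmf p -> (pmf_entropy p <= pmf_entropy (avg v p))%E.
Proof.
move=> pp; have [p0 _] := pp.
have := mixture_entropy_ge (uniform_pmf d0) (fun i => shift_pmf (v i) pp)
  (fun x => avg_mixture v x p0).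
under eq_esum do rewrite shift_entropy.
rewrite ge0_esumZr ?pmf_entropy_ge0 //.
by have [_ ->] := uniform_pmf (R := R) d0; rewrite mul1e.
Qed.

Lemma avg_entropy_le v p : is_pmf p ->
  (pmf_entropy (avg v p) <= pmf_entropy p + (ln d%:R)%:E)%E.
Proof.
move=> pp; have [p0 _] := pp.
have := mixture_entropy_le (uniform_pmf d0) (fun i => shift_pmf (v i) pp)
  (fun x => avg_mixture v x p0).
under eq_esum do rewrite shift_entropy.
rewrite ge0_esumZr ?pmf_entropy_ge0 // uniform_entropy //.
by have [_ ->] := uniform_pmf (R := R) d0; rewrite mul1e.
Qed.

(* Nonnegativity of the mutual information of the two coordinates of the
   (unnormalised) law [t] on pairs, whose marginals are both [d * r]. *)
Lemma eta_avg_submodular (t : 'I_d -> 'I_d -> R) (r : 'I_d -> R) (s : R) :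
  (forall i j, 0 <= t i j) -> (forall i j, t i j = t j i) ->
  (forall i, r i = d%:R^-1 * \sum_j t i j) -> s = d%:R^-1 * \sum_i r i ->
  eta s + d%:R^-1 * \sum_i d%:R^-1 * \sum_j eta (t i j) <=
  2 * (d%:R^-1 * \sum_i eta (r i)).
Proof.
move=> t0 tC rE sE.
have dR : 0 < d%:R :> R by rewrite ltr0n.
have dn : d%:R != 0 :> R by rewrite gt_eqF.
have r0 i : 0 <= r i by rewrite rE mulr_ge0 ?invr_ge0 ?sumr_ge0 // ltW.
have s0 : 0 <= s by rewrite sE mulr_ge0 ?invr_ge0 ?sumr_ge0 // ltW.
have tr i : \sum_j t i j = d%:R * r i by rewrite rE mulrA divff // mul1r.
have rs : \sum_i r i = d%:R * s by rewrite sE mulrA divff // mul1r.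
have tle i j : t i j <= d%:R * r i.
  by rewrite -tr (bigD1 j) //= lerDl sumr_ge0.
have rle i : r i <= d%:R * s by rewrite -rs (bigD1 i) //= lerDl sumr_ge0.
(* The total of [t] is [d * d * s], so [r i * r j / s] is the product of the two marginals divided
   by the total: the independent coupling against which Gibbs' inequality is applied. *)
have key i j : eta (t i j) + t i j <=
    (t i j * - ln (r i) + t i j * - ln (r j)) + t i j * ln s + r i * r j / s.
  have := t0 i j; rewrite le_eqVlt => /orP[/eqP <-|tp].
    by rewrite eta0 !mul0r !add0r mulr_ge0 ?invr_ge0 // mulr_ge0.
  have ri : 0 < r i by have := lt_le_trans tp (tle i j); rewrite pmulr_rgt0.
  have rj : 0 < r j.
    by have := tp; rewrite tC => /lt_le_trans/(_ (tle j i)); rewrite pmulr_rgt0.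
  have sp : 0 < s by have := lt_le_trans ri (rle i); rewrite pmulr_rgt0.
  have qp : 0 < r i * r j / s by rewrite divr_gt0 // mulr_gt0.
  have := eta_tangent (ltW tp) (ltW qp) => /(_ _)/le_trans; apply.
    by move=> q; rewrite q ltxx in qp.
  rewrite ln_div ?posrE ?mulr_gt0 // lnM ?posrE //.
  by rewrite lerD2r; lra.
have : \sum_i \sum_j (eta (t i j) + t i j) <= \sum_i \sum_j
    ((t i j * - ln (r i) + t i j * - ln (r j)) + t i j * ln s + r i * r j / s).
  by apply: ler_sum => i _; apply: ler_sum => j _; exact: key.
set A := \sum_i \sum_j eta (t i j); set B := \sum_i eta (r i).
have -> : \sum_i \sum_j (eta (t i j) + t i j) = A + d%:R * (d%:R * s).
  rewrite -rs mulr_sumr -big_split /=; apply: eq_bigr => i _.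
  by rewrite big_split /= tr.
have B2 : \sum_i \sum_j t i j * - ln (r i) = d%:R * B.
  by rewrite mulr_sumr; apply: eq_bigr => i _; rewrite -mulr_suml tr /eta; ring.
have B3 : \sum_i \sum_j t i j * - ln (r j) = d%:R * B.
  rewrite exchange_big -B2 /=.
  by apply: eq_bigr => i _; apply: eq_bigr => j _; rewrite tC.
have B4 : \sum_i \sum_j t i j * ln s = d%:R * d%:R * (s * ln s).
  under eq_bigr do rewrite -mulr_suml tr.
  by rewrite -mulr_suml -mulr_sumr rs; ring.
have B5 : \sum_i \sum_j r i * r j / s = d%:R * d%:R * s.
  under eq_bigr do rewrite -mulr_suml -mulr_sumr rs.
  rewrite -!mulr_suml rs; have [->|sn] := eqVneq s 0; first by rewrite !(mulr0, mul0r).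
  by field.
under [X in _ <= X]eq_bigr do rewrite !big_split /=.
rewrite !big_split /= B2 B3 B4 B5 => h.
rewrite -mulr_sumr -/A -(ler_pM2l (mulr_gt0 dR dR)).
have -> : d%:R * d%:R * (eta s + d%:R^-1 * (d%:R^-1 * A)) =
  A - d%:R * d%:R * (s * ln s) by rewrite /eta; field.
have -> : d%:R * d%:R * (2 * (d%:R^-1 * B)) = 2 * (d%:R * B) by field.
move: h; lra.
Qed.

(** For a fixed endpoint [x], the weights [p (x - v i - v j)] are, up to scaling, the conditional
    law of the last two balls. Their conditional mutual information is nonnegative, and the sum over
    [x] gives the claim once [esum_avg] has written the three entropies as sums of averages at a
    common endpoint. *)
Lemma avg_entropy_concave v p : is_pmf p ->
  (pmf_entropy (avg v (avg v p)) + pmf_entropy p <= 2%:E * pmf_entropy (avg v p))%E.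
Proof.
move=> pp; have pa := avg_pmf v pp; have paa := avg_pmf v pa.
have e0 (f : V -> R) x : is_pmf f -> 0 <= eta (f x) by move=> ?; exact: pmf_eta_ge0.
rewrite -[X in (_ + X)%E](esum_avg v (p := eta \o p)) => [|x]; last exact: e0.
rewrite -[X in (_ + X)%E](esum_avg v) => [|x]; last first.
  by apply: avg_ge0 => y; exact: e0.
rewrite -[X in (_ * X)%E](esum_avg v (p := eta \o avg v p)) => [|x]; last exact: e0.
rewrite -ge0_esumZl // => [|x]; last first.
  by rewrite lee_fin avg_ge0 // => y; exact: e0.
rewrite -esumD => [|x _|x _]; first last.
- by rewrite lee_fin avg_ge0 // => y; apply: avg_ge0 => z; exact: e0.
- by rewrite lee_fin; exact: e0.
apply: le_esum => x _; rewrite -EFinD -EFinM lee_fin.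
apply: (@eta_avg_submodular (fun i j => p (x - v i - v j))
  (fun i => avg v p (x - v i))) => //.
- by case: pp.
- by move=> i j; rewrite addrAC.
Qed.

End Averages.

(** Concavity and [0 <= f 0] make [f k / k] nonincreasing; [st] and [ra] state this with
    denominators cleared. Monotonicity of [f] fixes the sign of [f k - f N] on either side of
    [N]. *)
Lemma concave_ratio (R : realType) (f : nat -> R) (N : nat) :
  (forall k, 0 <= f k) -> (forall k, f k <= f k.+1) ->
  (forall k, f k.+2 + f k <= 2 * f k.+1) -> (0 < N)%N ->
  forall k, `|f k - f N| <= `|k%:R - N%:R| / N%:R * f N.
Proof.
move=> f0 fS fc N0 k.
have NR : 0 < N%:R :> R by rewrite ltr0n.
have fm : {homo f : i j / (i <= j)%N >-> i <= j}.
  by apply: homo_leq => // x y z; exact: le_trans.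
have st j : j%:R * f j.+1 <= j.+1%:R * f j.
  elim: j => [|j IH]; first by rewrite mul0r mul1r.
  have := ler_wpM2l (ler0n R j.+1) (fc j).
  rewrite -[j.+2]addn1 -[j.+1]addn1 !natrD in IH *; nra.
have ra i j : (i <= j)%N -> i%:R * f j <= j%:R * f i.
  elim: j => [|j IH]; first by rewrite leqn0 => /eqP ->.
  rewrite leq_eqVlt => /predU1P[->//|]; rewrite ltnS => /[dup] ij /IH h.
  have [i0|i0] := posnP i; first by rewrite i0 mul0r mulr_ge0.
  have j0 : 0 < j%:R :> R by rewrite ltr0n (leq_trans i0).
  rewrite -(ler_pM2l j0).
  have := ler_wpM2l (ler0n R i) (st j); have := ler_wpM2l (ler0n R j.+1) h.
  lra.
rewrite mulrAC ler_pdivlMr //; have [kN|Nk] := leqP k N.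
- rewrite !ler0_norm ?subr_le0 ?ler_nat ?fm //.
  by have := ra _ _ kN; lra.
- rewrite !ger0_norm ?subr_ge0 ?ler_nat ?fm // 1?ltnW //.
  by have := ra _ _ (ltnW Nk); lra.
Qed.

(** * Poisson weights and Poissonization *)

Section PoissonWeights.
Context {R : realType}.
Implicit Types s : R.

Lemma esum_series (a : nat -> R) (l : R) : (forall k, 0 <= a k) ->
  series a @ \oo --> l -> \esum_(k in setT) (a k)%:E = l%:E.
Proof.
move=> a0 al; rewrite -nneseries_esumT => [|k]; last by rewrite lee_fin.
rewrite -(cvg_lim _ al) // -EFin_lim; last by apply/cvg_ex; exists l.
by apply/congr_lim/funext => n /=; rewrite -sumEFin.
Qed.

Lemma jumps_pmf_ge0 s k : 0 <= s -> 0 <= jumps_pmf s k.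
Proof. by move=> s0; rewrite /jumps_pmf divr_ge0 // mulr_ge0 ?expR_ge0 ?exprn_ge0. Qed.

Lemma jumps_pmf_pmf s : 0 <= s -> is_pmf (jumps_pmf s).
Proof.
move=> s0; split=> [k|]; first exact: jumps_pmf_ge0.
have e0 k : 0 <= exp_coeff s k by rewrite exp_coeff_ge0.
have := @esum_series (exp_coeff s) (expR s) e0 (is_cvg_series_exp_coeff s) => h.
under eq_esum do rewrite /jumps_pmf -mulrA EFinM.
rewrite ge0_esumZl ?expR_ge0 // h -EFinM expRN mulVf ?gt_eqF ?expR_gt0 //.
Qed.

(** The size-bias recursion of the Poisson law; an index shift then gives the mean and the second
    factorial moment. *)
Lemma jumps_pmfS s k : k.+1%:R * jumps_pmf s k.+1 = s * jumps_pmf s k.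
Proof.
rewrite /jumps_pmf factS natrM exprS; field.
by rewrite pnatr_eq0 -lt0n fact_gt0 /= addrC natr1 pnatr_eq0.
Qed.

Lemma jumps_mean s : 0 <= s -> \esum_(k in setT) (k%:R * jumps_pmf s k)%:E = s%:E.
Proof.
move=> s0; have j0 k := jumps_pmf_ge0 k s0.
rewrite esum_nat_recl => [|k]; last by rewrite lee_fin mulr_ge0.
rewrite mul0r add0e; under eq_esum do rewrite jumps_pmfS EFinM.
by rewrite ge0_esumZl //; have [_ ->] := jumps_pmf_pmf s0; rewrite mule1.
Qed.

Lemma jumps_variance s : 0 <= s ->
  \esum_(k in setT) (jumps_pmf s k * (k%:R - s) ^+ 2)%:E = s%:E.
Proof.
move=> s0; have j0 k := jumps_pmf_ge0 k s0.
have m2 : \esum_(k in setT) (k%:R * (k%:R - 1) * jumps_pmf s k)%:E = (s * s)%:E.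
  rewrite esum_nat_recl => [|[|k]]; last 2 first.
  - by rewrite mul0r mul0r.
  - by rewrite lee_fin mulr_ge0 // mulr_ge0 // subr_ge0 ler1n.
  rewrite !mul0r add0e.
  rewrite (eq_esum (b := fun k => (s%:E * (k%:R * jumps_pmf s k)%:E)%E)).
    by rewrite ge0_esumZl ?jumps_mean // => k; rewrite lee_fin mulr_ge0.
  by move=> k _; rewrite -EFinM mulrAC jumps_pmfS -natr1; congr EFin; ring.
have v0 k : 0 <= jumps_pmf s k * (k%:R - s) ^+ 2 by rewrite mulr_ge0 ?sqr_ge0.
(* The square is expanded with its cross term moved to the left, so that every series has
   nonnegative terms. *)
have : (\esum_(k in setT) (jumps_pmf s k * (k%:R - s) ^+ 2)%:E +
    (2 * s)%:E * (\esum_(k in setT) (k%:R * jumps_pmf s k)%:E) =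
  \esum_(k in setT) (k%:R * (k%:R - 1) * jumps_pmf s k)%:E +
  (\esum_(k in setT) (k%:R * jumps_pmf s k)%:E +
   (s * s)%:E * \esum_(k in setT) (jumps_pmf s k)%:E))%E.
  rewrite -!ge0_esumZl ?mulr_ge0 //; last by move=> k; rewrite lee_fin mulr_ge0.
  have k0 k : 0 <= (k%:R - 1) * k%:R :> R.
    by case: k => [|k]; rewrite ?mulr0 // mulr_ge0 // subr_ge0 ler1n.
  rewrite -!esumD; last first.
  - by move=> k _; rewrite -EFinM lee_fin mulr_ge0 // mulr_ge0.
  - by move=> k _; rewrite lee_fin v0.
  - by move=> k _; rewrite -EFinM lee_fin mulr_ge0 // mulr_ge0.
  - by move=> k _; rewrite lee_fin mulr_ge0.
  - move=> k _; rewrite -EFinM -EFinD lee_fin.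
    by rewrite addr_ge0 // mulr_ge0 // mulr_ge0.
  - by move=> k _; rewrite lee_fin mulr_ge0 // mulrC.
  by apply: eq_esum => k _; rewrite -!EFinM -!EFinD; congr EFin; ring.
rewrite m2 jumps_mean //; have [_ ->] := jumps_pmf_pmf s0.
case: (esum _ _) => [x| |] //; rewrite -!EFinM -!EFinD => -[] h.
by congr EFin; lra.
Qed.

Lemma jumps_entropy_le s : 0 <= s ->
  (pmf_entropy (jumps_pmf s) <= (ln (s + 2) + 1)%:E)%E.
Proof.
move=> s0; have j0 k := jumps_pmf_ge0 k s0.
have [_ j1] := jumps_pmf_pmf s0; have jp := jumps_pmf_pmf s0.
have s2 : 0 < s + 2 by lra.
have s1 : 0 < s + 1 by lra.
(* Gibbs' inequality against the geometric law with mean [s + 1]. *)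
pose t := (s + 1) / (s + 2).
have t0 : 0 < t by rewrite divr_gt0.
have t1 : t < 1 by rewrite ltr_pdivrMr //; lra.
have tE : 1 - t = (s + 2)^-1 by rewrite /t; field; lra.
pose r k := geometric (1 - t) t k.
have r0 k : 0 < r k by rewrite /r /geometric /= mulr_gt0 ?exprn_gt0 // subr_gt0.
have r1 : \esum_(k in setT) (r k)%:E = 1%E.
  have -> : 1%E = ((1 - t) * (1 - t)^-1)%:E :> \bar R.
    by rewrite divff // gt_eqF // subr_gt0.
  apply: esum_series => [k|]; first exact: ltW.
  by apply: cvg_geometric_series; rewrite gtr0_norm.
(* This is [ln x <= x - 1] at [x = t^-1]. Multiplied by the Poisson mean [s] it contributes
   [s / (s + 1) <= 1]. Mean [s + 1] instead of [s] keeps [t] positive when [s = 0]. *)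
have lt1 : - ln t <= (s + 1)^-1.
  rewrite -lnV ?posrE //; have := @le_ln1Dx R (t^-1 - 1).
  rewrite addrCA subrr addr0 => /(_ _)/le_trans; apply.
    by rewrite ltrBDr addNr invr_gt0.
  by rewrite /t le_eqVlt; apply/orP; left; apply/eqP; field; lra.
have l2 : 0 <= ln (s + 2) by rewrite ln_ge0 //; lra.
have key k : eta (jumps_pmf s k) + jumps_pmf s k <=
    ln (s + 2) * jumps_pmf s k + (s + 1)^-1 * (k%:R * jumps_pmf s k) + r k.
  have := eta_tangent (j0 k) (ltW (r0 k)) => /(_ _)/le_trans; apply.
    by move=> rk; have := r0 k; rewrite rk ltxx.
  rewrite /r /geometric /= lnM ?posrE ?exprn_gt0 ?subr_gt0 // lnXn //.
  rewrite tE lnV ?posrE // lerD2r -[ln t *+ k]mulr_natl.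
  have := ler_wpM2l (mulr_ge0 (ler0n R k) (j0 k)) lt1; lra.
rewrite -(@leeD2rE _ 1%E) // -{1}j1 -esumD; last 2 first.
- by move=> k _; rewrite lee_fin; exact: (pmf_eta_ge0 k jp).
- by move=> k _; rewrite lee_fin.
have mk0 k : 0 <= k%:R * jumps_pmf s k by rewrite mulr_ge0.
apply: (@le_trans _ _ (\esum_(k in setT) ((ln (s + 2))%:E * (jumps_pmf s k)%:E +
   ((s + 1)^-1)%:E * (k%:R * jumps_pmf s k)%:E + (r k)%:E))%E).
  by apply: le_esum => k _; rewrite -!EFinM -!EFinD lee_fin; exact: key.
rewrite !esumD; first last.
- by move=> k _; rewrite lee_fin ltW.
- move=> k _; rewrite -!EFinM -EFinD lee_fin.
  by rewrite addr_ge0 // mulr_ge0 // invr_ge0 ltW.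
- by move=> k _; rewrite -EFinM lee_fin mulr_ge0 // invr_ge0 ltW.
- by move=> k _; rewrite -EFinM lee_fin mulr_ge0.
rewrite !ge0_esumZl // ?invr_ge0 ?(ltW s1) // j1 jumps_mean // r1 mule1.
rewrite -EFinM -!EFinD lee_fin lerD2r lerD2l mulrC ler_pdivrMr //; lra.
Qed.

End PoissonWeights.

(** * A Poisson number of balls *)

Section Poissonization.
Context {R : realType} {V : zmodType} {d : nat}.
Implicit Types (v u : 'I_d -> V) (p : V -> R) (s : R).

(* The law of X + v_(I_1) + .. + v_(I_K) for K Poisson(s) and the I_j uniform. *)
Definition pois v s p (x : V) : R :=
  fine (\esum_(k in setT) (jumps_pmf s k * iter k (avg v) p x)%:E).

Hypothesis d0 : (0 < d)%N.

Lemma iter_avg_pmf v p k : is_pmf p -> is_pmf (iter k (avg v) p).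
Proof. by move=> pp; elim: k => // k IH; exact: avg_pmf. Qed.

(** The series is dominated by the total Poisson mass 1, so [fine] loses nothing. *)
Lemma poisE v s p x : 0 <= s -> is_pmf p ->
  (pois v s p x)%:E = \esum_(k in setT) (jumps_pmf s k * iter k (avg v) p x)%:E.
Proof.
move=> s0 pp; have j0 k := jumps_pmf_ge0 k s0.
have i1 k := pmf_le1 x (iter_avg_pmf v k pp).
have i0 k : 0 <= iter k (avg v) p x by case: (iter_avg_pmf v k pp).
rewrite fineK // ge0_fin_numE; last by apply: esum_ge0 => k _; rewrite lee_fin mulr_ge0.
apply: (@le_lt_trans _ _ 1%E); last exact: ltry.
have [_ <-] := jumps_pmf_pmf s0.
by apply: le_esum => k _; rewrite lee_fin ler_piMr.
Qed.

Lemma pois_pmf v s p : 0 <= s -> is_pmf p -> is_pmf (pois v s p).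
Proof.
move=> s0 pp; apply: mixture_pmf (jumps_pmf_pmf s0) _ (fun x => poisE v x s0 pp).
by move=> k; exact: iter_avg_pmf.
Qed.

Lemma iter_avg_entropy_le v p k : is_pmf p ->
  (pmf_entropy (iter k (avg v) p) <= pmf_entropy p + (k%:R * ln d%:R)%:E)%E.
Proof.
move=> pp; elim: k => [|k IH]; first by rewrite mul0r adde0.
apply: (le_trans (avg_entropy_le d0 v (iter_avg_pmf v k pp))).
rewrite -[in leRHS]natr1 mulrDl mul1r EFinD addeA.
by rewrite leeD2r.
Qed.

Let iter_fin v p k : is_pmf p -> (pmf_entropy p < +oo)%E ->
  pmf_entropy (iter k (avg v) p) = (fine (pmf_entropy (iter k (avg v) p)))%:E.
Proof.
move=> pp fp; rewrite fineK // ge0_fin_numE ?pmf_entropy_ge0 //; last exact: iter_avg_pmf.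
apply: (le_lt_trans (iter_avg_entropy_le v k pp)).
by rewrite lte_add_pinfty // ltry.
Qed.

Lemma pois_entropy_fin v s p : 0 <= s -> is_pmf p -> (pmf_entropy p < +oo)%E ->
  (pmf_entropy (pois v s p) < +oo)%E.
Proof.
move=> s0 pp fp; have j0 k := jumps_pmf_ge0 k s0; have [_ j1] := jumps_pmf_pmf s0.
have H0 := pmf_entropy_ge0 pp.
have l0 : 0 <= ln d%:R :> R by rewrite ln_ge0 // ler1n.
apply: (le_lt_trans (mixture_entropy_le (jumps_pmf_pmf s0)
  (fun k => iter_avg_pmf v k pp) (fun x => poisE v x s0 pp))).
rewrite lte_add_pinfty //; last first.
  exact: le_lt_trans (jumps_entropy_le s0) (ltry _).
apply: (@le_lt_trans _ _ (\esum_(k in setT) ((jumps_pmf s k)%:E * pmf_entropy p +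
   (ln d%:R)%:E * (k%:R * jumps_pmf s k)%:E))%E).
  apply: le_esum => k _.
  apply: (le_trans (lee_wpmul2l _ (iter_avg_entropy_le v k pp))).
    by rewrite lee_fin.
  rewrite ge0_muleDr // ?lee_fin ?mulr_ge0 // leeD2l // -!EFinM lee_fin.
  by rewrite le_eqVlt; apply/orP; left; apply/eqP; ring.
rewrite esumD; first last.
- by move=> k _; rewrite -EFinM lee_fin mulr_ge0 // mulr_ge0.
- by move=> k _; rewrite mule_ge0 // lee_fin.
rewrite ge0_esumZr // j1 mul1e ge0_esumZl // => [|k]; last by rewrite lee_fin mulr_ge0.
by rewrite jumps_mean // -EFinM lte_add_pinfty // ltry.
Qed.

(** The starting law [p] is arbitrary so that the bound can serve twice, once for the balls of X and
    once for those of Y. The last summand bounds the entropy of the Poisson count itself. *)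
Lemma pois_entropy_bounds v p (N : nat) : (0 < N)%N ->
  is_pmf p -> (pmf_entropy p < +oo)%E ->
  `|fine (pmf_entropy (pois v N%:R p)) - fine (pmf_entropy (iter N (avg v) p))| <=
  fine (pmf_entropy (iter N (avg v) p)) / Num.sqrt N%:R + (ln (N%:R + 2) + 1).
Proof.
move=> N0 pp fp; have s0 : 0 <= N%:R :> R by [].
have NR : 0 < N%:R :> R by rewrite ltr0n.
have j0 k := jumps_pmf_ge0 k s0; have [_ j1] := jumps_pmf_pmf s0.
have ip k := iter_avg_pmf v k pp.
pose f k := fine (pmf_entropy (iter k (avg v) p)).
have fE k : pmf_entropy (iter k (avg v) p) = (f k)%:E by exact: iter_fin.
have f0 k : 0 <= f k by rewrite -lee_fin -fE pmf_entropy_ge0.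
have qf : pmf_entropy (pois v N%:R p) = (fine (pmf_entropy (pois v N%:R p)))%:E.
  have qfin := pois_entropy_fin v s0 pp fp.
  by rewrite fineK // ge0_fin_numE // pmf_entropy_ge0 //; exact: pois_pmf.
set r := Num.sqrt N%:R; have r0 : 0 < r by rewrite sqrtr_gt0.
have rr : r ^+ 2 = N%:R by rewrite sqr_sqrtr.
(* AM-GM: [2 |k - N| / sqrt N <= (k - N)^2 / N + 1], whose mean is 2. *)
pose u k := ((k%:R - N%:R) ^+ 2 / N%:R + 1) / (2 * r).
have u0 k : 0 <= u k.
  by rewrite divr_ge0 ?addr_ge0 ?divr_ge0 ?sqr_ge0 // mulr_ge0 // ltW.
have fu k : `|f k - f N| <= u k * f N.
  apply: le_trans (concave_ratio f0 _ _ N0 k) _.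
  - by move=> j; rewrite -lee_fin -!fE avg_entropy_ge.
  - move=> j; have := avg_entropy_concave d0 v (ip j).
    by rewrite -!iterS !fE -EFinM -EFinD lee_fin.
  apply: ler_wpM2r => //; rewrite /u ler_pdivlMr ?mulr_gt0 //.
  rewrite -[(_ - _) ^+ 2]real_normK ?num_real // -rr.
  set a := `|_ - _|; rewrite -subr_ge0.
  have -> : a ^+ 2 / r ^+ 2 + 1 - a / r ^+ 2 * (2 * r) = (a / r - 1) ^+ 2.
    by field; rewrite gt_eqF.
  exact: sqr_ge0.
have wu : \esum_(k in setT) (jumps_pmf N%:R k * (u k * f N))%:E = (f N / r)%:E.
  pose c := f N / (2 * r).
  have c0 : 0 <= c by rewrite divr_ge0 // mulr_ge0 // ltW.
  rewrite (eq_esum (b := fun k => ((c / N%:R)%:E *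
     (jumps_pmf N%:R k * (k%:R - N%:R) ^+ 2)%:E + c%:E * (jumps_pmf N%:R k)%:E)%E)).
    rewrite esumD; first last.
    - by move=> k _; rewrite -EFinM lee_fin mulr_ge0.
    - move=> k _; rewrite -EFinM lee_fin; apply: mulr_ge0; first exact: divr_ge0.
      by apply: mulr_ge0 => //; exact: sqr_ge0.
    rewrite !ge0_esumZl //.
      rewrite j1 jumps_variance // mule1 -EFinM -EFinD.
      by congr EFin; rewrite /c; field; rewrite !gt_eqF.
    - by rewrite divr_ge0.
    - by move=> k; rewrite lee_fin mulr_ge0 ?sqr_ge0.
  move=> k _; rewrite -!EFinM -EFinD; congr EFin; rewrite /u /c.
  by field; rewrite !gt_eqF.
have lo := mixture_entropy_ge (jumps_pmf_pmf s0) ip (fun x => poisE v x s0 pp).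
have hi := mixture_entropy_le (jumps_pmf_pmf s0) ip (fun x => poisE v x s0 pp).
pose S := \esum_(k in setT) ((jumps_pmf N%:R k)%:E * pmf_entropy (iter k (avg v) p))%E.
have fNE : (f N)%:E = \esum_(k in setT) (jumps_pmf N%:R k * f N)%:E.
  under eq_esum do rewrite EFinM.
  by rewrite ge0_esumZr ?lee_fin // j1 mul1e.
have S1 : (S <= (f N + f N / r)%:E)%E.
  rewrite EFinD -wu fNE -esumD; last 2 first.
  - by move=> k _; rewrite lee_fin mulr_ge0.
  - by move=> k _; rewrite lee_fin mulr_ge0 // mulr_ge0.
  apply: le_esum => k _; rewrite fE -!EFinM -EFinD lee_fin -mulrDr ler_wpM2l //.
  by have := fu k; rewrite ler_norml; lra.
have S2 : ((f N)%:E <= S + (f N / r)%:E)%E.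
  rewrite -wu fNE -esumD; last 2 first.
  - by move=> k _; rewrite fE -EFinM lee_fin mulr_ge0.
  - by move=> k _; rewrite lee_fin mulr_ge0 // mulr_ge0.
  apply: le_esum => k _; rewrite fE -!EFinM -EFinD lee_fin -mulrDr ler_wpM2l //.
  by have := fu k; rewrite ler_norml; lra.
have l0 : 0 <= ln (N%:R + 2 : R) by rewrite ln_ge0 //; lra.
rewrite -/(f N) ler_norml.
apply/andP; split.
- rewrite lerBrDr -lee_fin -qf; apply: le_trans lo.
  rewrite -(@leeD2rE _ (f N / r)%:E) //; apply: le_trans S2.
  by rewrite -EFinD lee_fin; lra.
- rewrite lerBlDr -lee_fin -qf; apply: (le_trans hi).
  rewrite [X in X%:E]addrC [X in X%:E]addrA EFinD; apply: leeD S1 _; exact: jumps_entropy_le.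
Qed.

Lemma avg_pois u v s p : 0 <= s -> is_pmf p ->
  avg u (pois v s p) =1 pois v s (avg u p).
Proof.
move=> s0 pp x; apply: EFin_inj.
have j0 k := jumps_pmf_ge0 k s0.
have ap := avg_pmf d0 u pp.
have i0 k y : 0 <= iter k (avg v) p y by case: (iter_avg_pmf v k pp).
rewrite poisE // avg_mixture; last by case: (pois_pmf v s0 pp).
have jd0 k i : (0 <= (jumps_pmf s k * (d%:R^-1 * iter k (avg v) p (x - u i)))%:E)%E.
  by rewrite lee_fin mulr_ge0 // mulr_ge0 // invr_ge0.
transitivity (\esum_(i in setT) \esum_(k in setT)
    (jumps_pmf s k * (d%:R^-1 * iter k (avg v) p (x - u i)))%:E).
  apply: eq_esum => i _; rewrite EFinM poisE // -ge0_esumZl ?invr_ge0 //.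
    by apply: eq_esum => k _; rewrite -EFinM mulrCA.
  by move=> k; rewrite lee_fin mulr_ge0.
rewrite esum_swap //; apply: eq_esum => k _.
have -> : iter k (avg v) (avg u p) = avg u (iter k (avg v) p).
  by elim: k {jd0} => //= k ->; apply/funext => y; rewrite avgC.
rewrite EFinM avg_mixture // -ge0_esumZl //.
by move=> i; rewrite lee_fin mulr_ge0 // ?invr_ge0.
Qed.

End Poissonization.

(** * Product laws and the Skellam distribution *)

Section ProductLaws.
Context {R : realType}.

(** Fubini, splitting off the first coordinate. The factors may vary with the coordinate and need
    not have sum 1: one use places [eta] in a single coordinate, another computes a convolution
    coordinatewise. *)
Lemma esum_prod_row d (f : 'I_d -> int -> R) (S : 'I_d -> R) :
  (forall i z, 0 <= f i z) -> (forall i, \esum_(z in setT) (f i z)%:E = (S i)%:E) ->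
  \esum_(x in [set: 'rV[int]_d]) (\prod_i f i (x 0 i))%:E = (\prod_i S i)%:E.
Proof.
elim: d f S => [|d IH] f S f0 fS.
  rewrite (esum_single (x0 := 0)) ?big_ord0 // => x; last first.
  by rewrite (_ : x = 0) ?eqxx //; apply/rowP => -[].
pose e (k : int * 'rV[int]_d) : 'rV[int]_d.+1 :=
  \row_i (if unlift ord0 i is Some j then k.2 0 j else k.1).
have e0 k : e k 0 ord0 = k.1 by rewrite mxE unlift_none.
have eS k j : e k 0 (lift ord0 j) = k.2 0 j by rewrite mxE liftK.
have eb : bijective e.
  exists (fun x : 'rV[int]_d.+1 => (x 0 ord0, \row_j x 0 (lift ord0 j))).
    move=> [z y]; rewrite e0; congr pair.
    by apply/rowP => j; rewrite mxE eS.
  move=> x; apply/rowP => i; case: (unliftP ord0 i) => [j|] ->.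
    by rewrite eS mxE.
  by rewrite e0.
have S0 : 0 <= S ord0 by rewrite -lee_fin -fS esum_ge0 // => z _; rewrite lee_fin.
rewrite (esum_bij _ eb) big_ord_recl.
rewrite (eq_esum (b := fun k : int * 'rV[int]_d =>
   (f ord0 k.1 * \prod_i f (lift ord0 i) (k.2 0 i))%:E)); last first.
  move=> k _; rewrite big_ord_recl e0; congr (_ * _)%:E.
  by apply: eq_bigr => i _; rewrite eS.
rewrite -(@esum_pair R int 'rV[int]_d
  (fun z y => (f ord0 z * \prod_i f (lift ord0 i) (y 0 i))%:E)); last first.
  by move=> z y; rewrite lee_fin mulr_ge0 ?prodr_ge0.
under eq_esum => z _.
  under eq_esum do rewrite EFinM.
  rewrite ge0_esumZl // => [|y]; last by rewrite lee_fin prodr_ge0.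
  rewrite (IH (fun i => f (lift ord0 i)) (fun i => S (lift ord0 i))) //; over.
rewrite ge0_esumZr // ?fS ?EFinM // lee_fin prodr_ge0 // => i _.
by rewrite -lee_fin -fS esum_ge0 // => z _; rewrite lee_fin.
Qed.

Lemma eta_prod d (a : 'I_d -> R) : (forall i, 0 <= a i) ->
  eta (\prod_i a i) = \sum_i \prod_j (if j == i then eta (a j) else a j).
Proof.
elim: d a => [|d IH] a a0; first by rewrite !big_ord0 /eta ln1 mulr0 oppr0.
rewrite big_ord_recl etaM ?prodr_ge0 // IH // [RHS]big_ord_recl; congr (_ + _).
  by rewrite big_ord_recl eqxx; congr (_ * _).
by rewrite mulr_sumr; apply: eq_bigr => i _; rewrite big_ord_recl.
Qed.

Lemma prod_row_entropy d (p : int -> R) : is_pmf p -> (pmf_entropy p < +oo)%E ->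
  pmf_entropy (fun x : 'rV[int]_d => \prod_i p (x 0 i)) =
  (d%:R%:E * pmf_entropy p)%E.
Proof.
move=> pp fp; have [p0 p1] := pp.
have e0 z : 0 <= eta (p z) by exact: pmf_eta_ge0.
have hE : pmf_entropy p = (fine (pmf_entropy p))%:E.
  by rewrite fineK // ge0_fin_numE // pmf_entropy_ge0.
set h := fine (pmf_entropy p) in hE.
rewrite /pmf_entropy (eq_esum (b := fun x : 'rV[int]_d => \sum_(i < d)
  (\prod_j (if j == i then eta (p (x 0 j)) else p (x 0 j)))%:E)%E); last first.
  by move=> x _; rewrite sumEFin -eta_prod.
rewrite esum_sum => [|x i _ _]; last first.
  by rewrite lee_fin prodr_ge0 // => j _; case: ifP.
transitivity (\sum_(i < d) h%:E)%E; last first.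
  by rewrite -/(pmf_entropy p) hE sumEFin sumr_const card_ord -[_ *+ _]mulr_natl EFinM.
apply: eq_bigr => i _.
rewrite (@esum_prod_row _ (fun j z => if j == i then eta (p z) else p z)
   (fun j => if j == i then h else 1)).
- by rewrite (bigD1 i) //= eqxx big1 ?mulr1 // => j /negPf ->.
- by move=> j z; case: ifP.
- by move=> j; case: ifP.
Qed.

(** Gibbs' inequality against the image under [phi] of the uniform law on [T], which has mass at
    least [#|T|^-1] at every point of the support of [p]; injectivity of [phi] is not assumed. *)
Lemma entropy_le_card (U : choiceType) (T : finType) (phi : T -> U) (p : U -> R) :
  is_pmf p -> (forall x, p x != 0 -> exists t, phi t = x) -> (0 < #|T|)%N ->
  (pmf_entropy p <= (ln #|T|%:R)%:E)%E.
Proof.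
move=> pp supp T0; have [p0 p1] := pp; set M : R := #|T|%:R.
have M0 : 0 < M by rewrite ltr0n.
have M1 : 1 <= M by rewrite ler1n.
have i0 x t : (0 <= (M^-1 * (phi t == x)%:R)%:E)%E.
  by rewrite lee_fin mulr_ge0 // invr_ge0 ltW.
rewrite -(@leeD2rE _ 1%E) // -{1}p1 -esumD; last 2 first.
- by move=> k _; rewrite lee_fin; exact: (pmf_eta_ge0 k pp).
- by move=> k _; rewrite lee_fin.
apply: (@le_trans _ _ (\esum_(x in setT) ((ln M)%:E * (p x)%:E +
   \sum_t (M^-1 * (phi t == x)%:R)%:E))%E).
  apply: le_esum => x _; rewrite sumEFin -EFinM -!EFinD lee_fin.
  have [px|px] := eqVneq (p x) 0.
    rewrite px ln0 // !mulr0 oppr0 !add0r sumr_ge0 // => t _.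
    by rewrite mulr_ge0 // invr_ge0 ltW.
  have Mi : 0 < M^-1 by rewrite invr_gt0.
  have := eta_tangent (p0 x) (ltW Mi) => /(_ _)/le_trans; apply.
    by move=> q; rewrite q ltxx in Mi.
  rewrite lnV ?posrE // opprK mulrC lerD2l.
  have [t <-] := supp x px; rewrite (bigD1 t) //= eqxx mulr1 lerDl sumr_ge0 // => u _.
  by rewrite mulr_ge0 // invr_ge0 ltW.
rewrite esumD; first last.
- by move=> x _; rewrite sume_ge0.
- by move=> x _; rewrite -EFinM lee_fin mulr_ge0 // ln_ge0.
rewrite ge0_esumZl ?ln_ge0 // p1 mule1 leeD2l // esum_sum //.
under eq_bigr => t _.
  rewrite (esum_single (x0 := phi t)) //; last first.
    by move=> x; rewrite eq_sym => /negPf ->; rewrite mulr0.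
  rewrite eqxx mulr1; over.
by rewrite sumEFin sumr_const -[_ *+ _]mulr_natl divff // gt_eqF.
Qed.

End ProductLaws.

(** * The walk at time 2s as a difference of two independent Poisson(s) counts *)

Section Skellam.
Context {R : realType}.
Implicit Types s : R.

Definition jumps_int s (z : int) : R := if 0 <= z then jumps_pmf s `|z|%N else 0.

Lemma jumps_int_ge0 s z : 0 <= s -> 0 <= jumps_int s z.
Proof. by move=> s0; rewrite /jumps_int; case: ifP => // _; exact: jumps_pmf_ge0. Qed.

Lemma esum_int_nat (a : int -> \bar R) : (forall z, z < 0 -> a z = 0%E) ->
  \esum_(z in setT) a z = \esum_(k in setT) a (Posz k).
Proof.
move=> an; rewrite -(esum_image setT Posz a); last by move=> x y _ _ [].
rewrite [RHS]esum_mkcond; apply: eq_esum => z _.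
case: ifPn => // /negP zn; case: z zn => [k|k] zn; last exact: an.
by case: zn; rewrite inE; exists k.
Qed.

Lemma jumps_int_pmf s : 0 <= s -> is_pmf (jumps_int s).
Proof.
move=> s0; split=> [z|]; first exact: jumps_int_ge0.
rewrite esum_int_nat => [|z z0]; last by rewrite /jumps_int leNgt z0.
by have [_ ] := jumps_pmf_pmf s0.
Qed.

Lemma jumps_int_entropy s : 0 <= s ->
  pmf_entropy (jumps_int s) = pmf_entropy (jumps_pmf s).
Proof.
move=> s0; rewrite /pmf_entropy esum_int_nat // => z z0.
by rewrite /jumps_int leNgt z0 mul0r oppr0.
Qed.

Lemma sum_signs m (b : {ffun 'I_m -> bool}) :
  \sum_i (-1) ^+ b i = m%:Z - (#|[set i | b i]%SET| + #|[set i | b i]%SET|)%:Z.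
Proof.
rewrite (eq_bigr (fun i => 1 - (b i : nat)%:Z *+ 2)) => [|i _]; last by case: (b i).
rewrite big_split /= sumr_const card_ord sumrN -mulr_natl mulr1; congr (_ - _).
  by rewrite natz.
rewrite sumrMnl /= PoszD -mulr2n; congr (_ *+ 2).
rewrite -sum1_card [in RHS]big_mkcond /= -[RHS]natz natr_sum.
by apply: eq_bigr => i _; rewrite inE; case: (b i).
Qed.

Lemma card_signs m j :
  #|[pred b : {ffun 'I_m -> bool} | \sum_i (-1) ^+ b i == m%:Z - (j + j)%:Z]| =
  'C(m, j).
Proof.
rewrite -[in RHS](card_ord m) -card_draws.
pose F (b : {ffun 'I_m -> bool}) : {set 'I_m} := [set i | b i]%SET.
have Fi : injective F.
  by move=> b c /finset.setP bc; apply/ffunP => i; have := bc i; rewrite !inE.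
rewrite -(card_imset _ Fi); apply: eq_card => A; rewrite inE.
have sE b := sum_signs b.
apply/imsetP/eqP => [[b]|Aj].
  by rewrite inE sE -/(F b) => /eqP h ->; move: h; set c := #|F b|; lia.
exists [ffun i => i \in A]; first rewrite inE sE.
  by rewrite (_ : [set i | _]%SET = A) ?Aj //; apply/finset.setP => i; rewrite inE ffunE.
by apply/finset.setP => i; rewrite inE ffunE.
Qed.

(** Poisson thinning: among the [m] jumps, [z] go down and [k + z] go up, and these two counts are
    independent Poisson(s). The constraint [k + z + z = m] leaves at most one [z]. *)
Lemma walk_jumps s m (k : int) : 0 <= s ->
  (jumps_pmf (2 * s) m * walk_pmf R m k)%:E =
  \esum_(z in setT) ((k + z + z == m%:Z)%:R * (jumps_int s (k + z) * jumps_int s z))%:E.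
Proof.
move=> s0; have j0 z := jumps_int_ge0 z s0.
have [[j kj]|nj] := pselect (exists j : nat, k = m%:Z - (j + j)%:Z); last first.
  rewrite /walk_pmf eq_card0 ?mul0r ?mulr0 => [|b]; last first.
    rewrite inE; apply/negP => /eqP bk; apply: nj.
    exists #|[set i | b i]%SET|; rewrite -bk; exact: sum_signs.
  rewrite esum1 // => z _; case: eqP => [kz|]; last by rewrite mul0r.
  rewrite /jumps_int; case: z kz => [j|j] kz; last by rewrite !mulr0.
  by case: nj; exists j; rewrite -kz; ring.
rewrite (esum_single (x0 := Posz j)); last 2 first.
- by rewrite lee_fin mulr_ge0 // mulr_ge0.
- move=> z zj; case: eqP => [kz|]; last by rewrite mul0r.
  by case/eqP: zj; lia.
rewrite /walk_pmf {1}kj card_signs; congr EFin.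
have -> : k + j%:Z + j%:Z == m%:Z by apply/eqP; rewrite kj; ring.
rewrite mul1r; have [jm|mj] := leqP j m; last first.
  rewrite bin_small // mul0r mulr0 {1}/jumps_int.
  by rewrite ifF ?mul0r //; apply/negP; lia.
have -> : k + j%:Z = (m - j)%N by lia.
rewrite /jumps_int /= /jumps_pmf.
have := bin_fact jm; move: (m - j)%N (subnK jm) => i im bf.
rewrite -im in bf *; rewrite -bf !natrM.
rewrite (_ : expR (- (2 * s)) = expR (- s) * expR (- s)); last first.
  by rewrite -expRD; congr expR; ring.
rewrite exprMn !exprD; field.
rewrite !pnatr_eq0 -!lt0n !fact_gt0 bin_gt0 leq_addl /=.
by rewrite !expf_neq0 ?pnatr_eq0.
Qed.

Lemma srw_pmf_jumps s (k : int) : 0 <= s ->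
  (srw_pmf (2 * s) k)%:E =
  \esum_(z in setT) (jumps_int s z * jumps_int s (k + z))%:E.
Proof.
move=> s0; have j0 z := jumps_int_ge0 z s0.
have jp := jumps_int_pmf s0.
have E : (\sum_(0 <= m <oo) (jumps_pmf (2 * s) m * walk_pmf R m k)%:E)%E =
    \esum_(z in setT) (jumps_int s z * jumps_int s (k + z))%:E.
  rewrite nneseries_esumT => [|m]; last first.
    by rewrite lee_fin mulr_ge0 ?jumps_pmf_ge0 ?mulr_ge0 // divr_ge0 // exprn_ge0.
  under eq_esum do rewrite walk_jumps //.
  rewrite esum_swap => [|m z]; last by rewrite lee_fin mulr_ge0 // mulr_ge0.
  apply: eq_esum => z _.
  rewrite (esum_single (x0 := `|(k + z + z)%R|%N)); last 2 first.
  - by rewrite lee_fin mulr_ge0 // mulr_ge0.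
  - move=> m mz; case: eqP => [kz|]; last by rewrite mul0r.
    by case/eqP: mz; rewrite kz.
  rewrite [in RHS]mulrC; case: eqP => [|kz]; first by rewrite mul1r.
  (* Here [k + z + z] is negative, so one of the counts [k + z] and [z] is negative and its mass
     vanishes. *)
  rewrite mul0r /jumps_int; case: ifP => kz0; case: ifP => z0; rewrite ?mulr0 ?mul0r //.
  by case: kz; rewrite gez0_abs //; lia.
rewrite /srw_pmf E fineK // ge0_fin_numE; last first.
  by apply: esum_ge0 => z _; rewrite lee_fin mulr_ge0.
apply: (@le_lt_trans _ _ 1%E); last exact: ltry.
have [_ <-] := jp; apply: le_esum => z _.
by rewrite lee_fin ler_piMr // pmf_le1.
Qed.

Lemma srw_pmf_entropy_fin s : 0 <= s ->
  is_pmf (srw_pmf (2 * s)) /\ (pmf_entropy (srw_pmf (2 * s)) < +oo)%E.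
Proof.
move=> s0; have jp := jumps_int_pmf s0.
have sp z : is_pmf (fun k => jumps_int s (k + z)).
  have := shift_pmf (- z) jp; rewrite (_ : (fun x => _) = fun k => jumps_int s (k + z)) //.
  by apply/funext => k; rewrite opprK.
have He z : pmf_entropy (fun k => jumps_int s (k + z)) = pmf_entropy (jumps_int s).
  rewrite -(shift_entropy (- z) (jumps_int s)); congr pmf_entropy.
  by apply/funext => k; rewrite opprK.
have E k := srw_pmf_jumps k s0.
split; first exact: (mixture_pmf jp sp E).
apply: (le_lt_trans (mixture_entropy_le jp sp E)).
under eq_esum do rewrite He.
rewrite ge0_esumZr; [|by case: jp|exact: pmf_entropy_ge0].
have [_ ->] := jp; rewrite mul1e jumps_int_entropy //.
by rewrite lte_add_pinfty // (le_lt_trans (jumps_entropy_le s0)) // ltry.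
Qed.

End Skellam.

(** * Differences of multinomials *)

Section PointMass.
Context {R : realType} {V : zmodType}.

Definition point_mass : V -> R := fun x => (x == 0)%:R.

Lemma point_mass_opp : (fun x => point_mass (- x)) = point_mass.
Proof. by apply/funext => x; rewrite /point_mass oppr_eq0. Qed.

Lemma point_mass_pmf : is_pmf point_mass.
Proof.
split=> [x|]; first by rewrite /point_mass.
rewrite (esum_single (x0 := 0)) ?lee_fin /point_mass ?eqxx //.
by move=> x /negPf ->.
Qed.

Lemma point_mass_entropy : pmf_entropy point_mass = 0%E.
Proof.
rewrite /pmf_entropy esum1 // => x _; rewrite /point_mass.
by case: eqP => _; rewrite ?ln1 ?mulr0 ?mul0r oppr0.
Qed.

Context {d : nat}.
Implicit Types (v : 'I_d -> V) (p : V -> R).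

Lemma iter_avg_ge0 v p m : (forall x, 0 <= p x) ->
  forall x, 0 <= iter m (avg v) p x.
Proof. by move=> p0; elim: m => //= m IH; exact: avg_ge0. Qed.

Lemma iter_avg_opp v p m x :
  iter m (avg v) p (- x) = iter m (avg (fun i => - v i)) (fun y => p (- y)) x.
Proof.
elim: m x => [//|m IH] x /=; rewrite /avg; congr (_ * _).
by apply: eq_bigr => i _; rewrite opprK -IH opprD.
Qed.

(* The law of X - Y for Y of law p and X an independent m-step walk from 0; it is
   also that of the walk started at - Y. *)
Lemma conv_iter_avg v p m x : (forall y, 0 <= p y) ->
  \esum_(y in setT) (iter m (avg v) point_mass (x + y) * p y)%:E =
  (iter m (avg v) (fun y => p (- y)) x)%:E.
Proof.
move=> p0; have i0 n y : 0 <= iter n (avg v) point_mass y.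
  by apply: iter_avg_ge0 => z; rewrite /point_mass.
elim: m x => [|m IH] x /=.
  rewrite (esum_single (x0 := - x)) /point_mass ?subrr ?eqxx ?mul1r ?lee_fin //.
  by move=> y; rewrite addrC addr_eq0 => /negPf ->; rewrite mul0r.
under eq_esum => y _.
  rewrite /avg -mulrA mulr_suml EFinM -sumEFin; over.
rewrite ge0_esumZl ?invr_ge0 // => [|y]; last first.
  by apply: sume_ge0 => i _; rewrite lee_fin mulr_ge0.
rewrite esum_sum => [|y i _ _]; last by rewrite lee_fin mulr_ge0.
rewrite /avg EFinM -sumEFin; congr (_ * _)%E; apply: eq_bigr => i _.
by rewrite -IH; apply: eq_esum => y _; rewrite addrAC.
Qed.

End PointMass.

(** * The multinomial law as an iterated average, and its Poissonization *)

Section Multinomial.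
Context {R : realType} (d : nat).
Hypothesis d0 : (0 < d)%N.

Definition unit_step (i : 'I_d) : 'rV[int]_d := delta_mx 0 i.

Let dR : d%:R != 0 :> R. Proof. by rewrite pnatr_eq0 -lt0n. Qed.

Lemma prod_uniform (x : 'rV[int]_d) :
  \prod_i uniform_param R d 0 i ^+ absz (x 0 i) = d%:R ^- (\sum_i `|x 0%R i|)%N.
Proof.
rewrite -exprVn -prodrXr; apply: eq_bigr => i _; by rewrite mxE.
Qed.

(** Induction on the last ball. Removing it from cell [i] leaves a mass proportional to [x 0 i], and
    these entries add up to [N.+1]. *)
Lemma multinomialE N : multinomial_pmf N (uniform_param R d) =
  iter N (avg unit_step) point_mass.
Proof.
elim: N => [|N IH]; apply/funext => x.
  rewrite /multinomial_pmf /= /point_mass; case: ifPn => [/andP[/forallP x0 /eqP s0]|nx].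
    have -> : x = 0.
      apply/rowP => i; rewrite mxE; apply/eqP.
      have /eqP := s0; rewrite psumr_eq0 => [/allP/(_ i)|j _]; last exact: x0.
      by rewrite mem_index_enum => /(_ isT)/implyP/(_ isT).
    by rewrite eqxx !big1 ?fact0 ?divr1 ?mulr1 // => i _; rewrite !mxE.
  case: eqP => // x0; case/negP: nx; rewrite x0; apply/andP; split.
    by apply/forallP => i; rewrite mxE.
  by rewrite big1 // => i _; rewrite mxE.
rewrite iterS -IH /avg.
have sumx i : \sum_j (x - unit_step i) 0 j = \sum_j x 0 j - 1.
  rewrite -[1](_ : \sum_j unit_step i 0 j = 1).
    by rewrite -sumrB; apply: eq_bigr => j _; rewrite !mxE.
  rewrite (bigD1 i) //= mxE !eqxx big1 ?addr0 // => j ji.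
  by rewrite mxE (negPf ji) andbF.
have [/forallP x0|] := boolP [forall i, 0 <= x 0 i]; last first.
  rewrite negb_forall => /existsP[j xj]; rewrite /multinomial_pmf ifF; last first.
    by apply/negP => /andP[/forallP/(_ j)]; rewrite (negPf xj).
  rewrite big1 ?mulr0 // => i _; rewrite ifF //.
  apply/negP => /andP[/forallP/(_ j) + _]; rewrite !mxE; case: (_ && _) => /=; lia.
have [sx|sx] := eqVneq (\sum_i x 0 i) N.+1; last first.
  rewrite /multinomial_pmf (negPf sx) andbF big1 ?mulr0 // => i _.
  by rewrite ifF // sumx; apply/negP => /andP[_ /eqP h]; case/eqP: sx; lia.
have sxa : (\sum_i `|x 0%R i|)%N = N.+1.
  apply/eqP; rewrite -eqz_nat -sx -natz natr_sum; apply/eqP/eq_bigr => i _.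
  by rewrite natz gez0_abs.
rewrite {1}/multinomial_pmf; case: ifPn => [_|]; last first.
  by rewrite sx eqxx andbT => /negP[]; apply/forallP.
rewrite prod_uniform sxa.
set D := (\prod_i (absz (x 0%R i))`!)%N.
have term i : multinomial_pmf N (uniform_param R d) (x - unit_step i) =
    (N`!)%:R / D%:R * d%:R ^- N * `|x 0%R i|%N%:R.
  have [xi|xi] := eqVneq (x 0 i) 0.
    rewrite xi mulr0 /multinomial_pmf ifF //; apply/negP => /andP[/forallP/(_ i)].
    by rewrite !mxE !eqxx xi.
  have xi1 : 0 < x 0 i by rewrite lt_def xi x0.
  have xE j : (x - unit_step i) 0 j = if j == i then x 0 j - 1 else x 0 j.
    by rewrite !mxE eqxx; case: eqP => _; rewrite ?subr0.
  rewrite /multinomial_pmf ifT; last first.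
    rewrite sumx sx; apply/andP; split; last by apply/eqP; lia.
    by apply/forallP => j; rewrite xE; case: eqP => [->|_ //]; lia.
  rewrite prod_uniform.
  have -> : (\sum_j `|(x - unit_step i)%R 0%R j|)%N = N.
    apply/eqP; rewrite -eqSS -sxa (bigD1 i) //= [X in _ == X](bigD1 i) //= xE eqxx.
    rewrite (eq_bigr (fun j => `|x 0%R j|%N)) => [|j /negPf ji]; last by rewrite xE ji.
    by rewrite -addSn eqn_add2r; apply/eqP; lia.
  rewrite /D (bigD1 i) //= [in RHS](bigD1 i) //= xE eqxx.
  rewrite (eq_bigr (fun j => (`|x 0%R j|%N)`!)) => [|j /negPf ji]; last by rewrite xE ji.
  have -> : `|x 0%R i|%N = (`|(x 0 i - 1)%R|%N).+1 by lia.
  set P := (\prod_(j < d | _) _)%N; have P0 : P%:R != 0 :> R.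
    by rewrite pnatr_eq0 -lt0n prodn_gt0 // => j; rewrite fact_gt0.
  rewrite factS !natrM; field.
  by rewrite expf_neq0 // P0 [1 + _]addrC natr1 !pnatr_eq0 -lt0n fact_gt0.
under eq_bigr do rewrite term.
rewrite -mulr_sumr -natr_sum sxa factS natrM exprS.
have D0 : D%:R != 0 :> R.
  by rewrite pnatr_eq0 -lt0n prodn_gt0 // => j; rewrite fact_gt0.
by field; rewrite D0 dR expf_neq0.
Qed.

(** A Poisson(s) number of balls gives independent Poisson(s / d) cell counts. Only the term with
    [m] equal to the sum of the entries of [x] survives. *)
Lemma prod_jumps_int (s : R) (x : 'rV[int]_d) : 0 <= s ->
  (\prod_i jumps_int (s / d%:R) (x 0 i))%:E =
  \esum_(m in setT) (jumps_pmf s m * iter m (avg unit_step) point_mass x)%:E.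
Proof.
move=> s0; have [/forallP x0|] := boolP [forall i, 0 <= x 0 i]; last first.
  rewrite negb_forall => /existsP[j xj].
  rewrite esum1 => [|m _]; last first.
    rewrite -multinomialE /multinomial_pmf ifF ?mulr0 //.
    by apply/negP => /andP[/forallP/(_ j)]; rewrite (negPf xj).
  by rewrite (bigD1 j) //= /jumps_int (negPf xj) mul0r.
pose n := (\sum_i `|x 0%R i|)%N.
have sx : \sum_i x 0 i = n.
  rewrite -natz natr_sum; apply: eq_bigr => i _; by rewrite natz gez0_abs.
rewrite (esum_single (x0 := n)); last 2 first.
- by rewrite lee_fin mulr_ge0 ?jumps_pmf_ge0 // iter_avg_ge0.
- move=> m mn; rewrite -multinomialE /multinomial_pmf ifF ?mulr0 // sx.
  by apply/negP => /andP[_ /eqP[] nm]; case/eqP: mn.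
rewrite -multinomialE /multinomial_pmf ifT; last first.
  by rewrite sx eqxx andbT; apply/forallP.
rewrite prod_uniform -/n; congr EFin.
under eq_bigr do rewrite /jumps_int x0 /jumps_pmf.
rewrite big_split /= big_split /= prodr_const card_ord -expRM_natl.
rewrite prodrXr -/n prodfV natr_prod.
rewrite /jumps_pmf expr_div_n.
have -> : d%:R * - (s / d%:R) = - s by field.
have D0 : \prod_i (absz (x 0 i))`!%:R != 0 :> R.
  by apply/prodf_neq0 => i _; rewrite pnatr_eq0 -lt0n fact_gt0.
field.
by rewrite D0 expf_neq0 // pnatr_eq0 -lt0n fact_gt0.
Qed.

End Multinomial.

(** * The law of the difference, with fixed and with Poisson counts *)

Section DifferenceLaw.
Context {R : realType} (d : nat).
Hypothesis d0 : (0 < d)%N.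

Definition neg_unit_step (i : 'I_d) : 'rV[int]_d := - unit_step i.

Lemma pois_unit_step_opp (s : R) x : 0 <= s ->
  pois (@unit_step d) s point_mass (- x) = pois neg_unit_step s point_mass x.
Proof.
move=> s0; apply: EFin_inj; rewrite !poisE //; try exact: point_mass_pmf.
apply: eq_esum => m _; rewrite iter_avg_opp; congr (_ * _)%:E.
by rewrite point_mass_opp.
Qed.

(** Both sides are the law of the difference of two independent vectors with independent Poisson(s /
    d) entries. The left side takes differences coordinatewise; the right side expands the first
    vector over its number of balls and convolves each term by [conv_iter_avg]. *)
Lemma prod_srw_pmf (s : R) : 0 <= s ->
  (fun x : 'rV[int]_d => \prod_i srw_pmf (2 * s / d%:R) (x 0 i)) =
  pois (@unit_step d) s (pois neg_unit_step s point_mass).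
Proof.
move=> s0; have dR : 0 < d%:R :> R by rewrite ltr0n.
pose t := s / d%:R; have t0 : 0 <= t by rewrite divr_ge0.
have pm := @point_mass_pmf R 'rV[int]_d.
have jt z := jumps_int_ge0 z t0.
pose J (y : 'rV[int]_d) : R := \prod_i jumps_int t (y 0 i).
have J0 y : 0 <= J y by rewrite prodr_ge0.
have JE y : J y = pois (@unit_step d) s point_mass y.
  by apply: EFin_inj; rewrite poisE // /J prod_jumps_int.
apply/funext => x; apply: EFin_inj.
have -> : 2 * s / d%:R = 2 * t by rewrite mulrA.
rewrite -(@esum_prod_row _ _ (fun i z => jumps_int t z * jumps_int t (x 0 i + z)));
  first last.
- by move=> i; rewrite srw_pmf_jumps.
- by move=> i z; rewrite mulr_ge0.
rewrite poisE //; last exact: pois_pmf.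
transitivity (\esum_(y in setT) \esum_(m in setT)
    (jumps_pmf s m * (iter m (avg (@unit_step d)) point_mass (x + y) * J y))%:E).
  apply: eq_esum => y _; rewrite big_split /= -/(J y) mulrC.
  under eq_esum do rewrite mulrA EFinM.
  rewrite ge0_esumZr ?lee_fin // => [|m]; last first.
    by rewrite mulr_ge0 ?jumps_pmf_ge0 // iter_avg_ge0.
  rewrite -prod_jumps_int // -EFinM; congr (_ * _)%:E.
  by apply: eq_bigr => i _; rewrite mxE.
rewrite esum_swap => [|y m]; last first.
  by rewrite lee_fin mulr_ge0 ?jumps_pmf_ge0 // mulr_ge0 // iter_avg_ge0.
apply: eq_esum => m _; under eq_esum do rewrite EFinM.
rewrite ge0_esumZl ?jumps_pmf_ge0 // => [|y]; last first.
  by rewrite lee_fin mulr_ge0 // iter_avg_ge0.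
rewrite conv_iter_avg // -EFinM; congr (_ * _)%:E.
rewrite (_ : (fun y => J (- y)) = pois neg_unit_step s point_mass) //.
by apply/funext => y; rewrite JE pois_unit_step_opp.
Qed.

(* The law of X_m - Y_n for independent X_m and Y_n, uniform multinomials with
   m and n trials. *)
Definition diff_pmf m n : 'rV[int]_d -> R :=
  iter m (avg (@unit_step d)) (iter n (avg neg_unit_step) point_mass).

Lemma diff_pmf_pmf m n : is_pmf (diff_pmf m n).
Proof. by do 2 apply: iter_avg_pmf => //; exact: point_mass_pmf. Qed.

Lemma avg_box (v : 'I_d -> 'rV[int]_d) (a b : nat) (p : 'rV[int]_d -> R) :
  (forall i j, - (b : int) <= v i 0 j <= (a : int)) ->
  forall a' b' : nat,
  (forall x, p x != 0 -> forall i, - (b' : int) <= x 0 i <= (a' : int)) ->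
  forall x, avg v p x != 0 -> forall i, - ((b + b')%N : int) <= x 0 i <= ((a + a')%N : int).
Proof.
move=> vb a' b' pb x ax j.
have [i pi] : exists i, p (x - v i) != 0.
  apply/existsP; apply: contra_neqT ax; rewrite negb_exists => /forallP px.
  rewrite /avg big1 ?mulr0 // => i _; apply/eqP; by rewrite -[_ == _]negbK px.
have := pb _ pi j; have := vb i j; rewrite !mxE.
by move: (x 0 j) (v i 0 j) => y z; lia.
Qed.

Lemma diff_pmf_box m n x : diff_pmf m n x != 0 ->
  forall i, - (n : int) <= x 0 i <= (m : int).
Proof.
have up : forall i j, - (0%N : int) <= @unit_step d i 0 j <= (1%N : int).
  by move=> i j; rewrite mxE eqxx; case: eqP.
have un : forall i j, - (1%N : int) <= neg_unit_step i 0 j <= (0%N : int).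
  by move=> i j; rewrite !mxE eqxx; case: eqP.
rewrite /diff_pmf; elim: m x => [|m IH] x /=; last first.
  exact: (avg_box up (a' := m) (b' := n)).
elim: n x => [|n IH] x /=; last exact: (avg_box un (a' := 0) (b' := n)).
by rewrite /point_mass; have [-> _ i|_] := eqVneq x 0; rewrite ?mxE ?eqxx.
Qed.

(** Each coordinate takes one of the [m + n + 1] values from [- n] to [m]. *)
Lemma diff_entropy_le m n :
  (pmf_entropy (diff_pmf m n) <= (d%:R * ln (m + n).+1%:R)%:E)%E.
Proof.
pose phi (t : {ffun 'I_d -> 'I_(m + n).+1}) : 'rV[int]_d :=
  \row_i ((t i : nat)%:Z - n%:Z).
apply: (@le_trans _ _ (ln #|{: {ffun 'I_d -> 'I_(m + n).+1}}|%:R)%:E).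
  apply: (@entropy_le_card _ _ _ phi); first exact: diff_pmf_pmf.
    move=> x /diff_pmf_box xb.
    exists [ffun i => inord `|(x 0 i + n%:Z)%R|%N].
    apply/rowP => i; rewrite mxE ffunE; move: (x 0 i) (xb i) => z zb.
    by rewrite inordK; lia.
  by rewrite card_ffun !card_ord expn_gt0.
by rewrite card_ffun !card_ord natrX lnXn ?ltr0n // mulr_natl.
Qed.

End DifferenceLaw.

(** * From random variables to mass functions *)

Section RandomVariables.
Context {R : realType} (disp : measure_display) (T : measurableType disp).
Variable P : probability T R.

Lemma measure_countable_bigcup (U : countType) (F : U -> set T) :
  (forall y, measurable (F y)) -> trivIset setT F ->
  P (\bigcup_y F y) = \esum_(y in setT) P (F y).
Proof.
move=> mF tF.
pose G k := if unpickle k is Some y then F y else set0.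
have Gp y : G (pickle y) = F y by rewrite /G pickleK.
pose D : set nat := range (@pickle U).
have -> : \bigcup_y F y = \bigcup_(k in D) G k.
  apply/seteqP; split => [w [y _ Fy]|w [_ [y _ <-]]]; last by rewrite Gp => Fy; exists y.
  by exists (pickle y); [exists y|rewrite Gp].
rewrite measure_bigcup.
- rewrite nneseries_esum // set_mem_set esum_image.
    by apply: eq_esum => y _; rewrite Gp.
  by move=> x y _ _; exact: (pcan_inj (@pickleK U)).
- by move=> _ [y _ <-]; rewrite Gp.
- move=> _ _ [y _ <-] [z _ <-] [w]; rewrite !Gp => yz; congr pickle.
  by apply: tF => //; exists w.
Qed.

Lemma discrete_rv_fine (U : choiceType) (X : T -> U) (A : set U) :
  discrete_rv X -> P (X @^-1` A) = (fine (P (X @^-1` A)))%:E.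
Proof. by move=> mX; rewrite fineK // fin_num_measure. Qed.

Lemma rv_pmf_diff d N (X Y : T -> 'rV[int]_d) : (0 < d)%N ->
  multinomial_rv P N (uniform_param R d) X ->
  multinomial_rv P N (uniform_param R d) Y -> independent_rv P X Y ->
  rv_pmf P (fun w => X w - Y w) = @diff_pmf R d N N.
Proof.
move=> d0 [mX XE] [mY YE] XY; apply/funext => x; rewrite /rv_pmf.
have -> : (fun w => X w - Y w) @^-1` [set x] =
    \bigcup_y (X @^-1` [set x + y] `&` Y @^-1` [set y]).
  apply/seteqP; split => w /=.
    by move=> <-; exists (Y w) => //; split => //=; rewrite subrK.
  by move=> [y _ [/= -> ->]]; rewrite addrK.
rewrite (@measure_countable_bigcup 'rV[int]_d); first last.
- by move=> y z _ _ [w [[_ /= <-] [_ /= <-]]].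
- by move=> y; apply: measurableI; [exact: mX|exact: mY].
rewrite (eq_esum (b := fun y => (iter N (avg (@unit_step d)) point_mass (x + y) *
    iter N (avg (@unit_step d)) point_mass y)%:E)); last first.
  move=> y _; rewrite XY (discrete_rv_fine _ mX) (discrete_rv_fine _ mY) -EFinM.
  by rewrite -!/(rv_pmf P _ _) XE YE multinomialE.
rewrite conv_iter_avg; last by apply: iter_avg_ge0 => y; rewrite /point_mass.
rewrite /diff_pmf /=; congr (fine (iter N _ _ x)%:E).
by apply/funext => y; rewrite iter_avg_opp point_mass_opp.
Qed.

End RandomVariables.

(** * The entropy gap *)

Section EntropyGap.
Context {R : realType}.

Lemma iter_avgC (V : zmodType) d (u v : 'I_d -> V) (p : V -> R) m n :
  iter m (avg u) (iter n (avg v) p) = iter n (avg v) (iter m (avg u) p).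
Proof.
have c1 k (q : V -> R) : avg u (iter k (avg v) q) = iter k (avg v) (avg u q).
  elim: k => // k IH; rewrite !iterS -IH; apply/funext => x; exact: avgC.
by elim: m => // m IH; rewrite !iterS IH c1.
Qed.

Lemma iter_avg_pois (V : zmodType) d (u v : 'I_d -> V) (s : R) (p : V -> R) m :
  (0 < d)%N -> 0 <= s -> is_pmf p ->
  iter m (avg u) (pois v s p) = pois v s (iter m (avg u) p).
Proof.
move=> d0 s0 pp; elim: m => //= m ->; apply/funext => x; apply: avg_pois => //.
exact: iter_avg_pmf.
Qed.

(** The proof passes through [h1], the entropy with Y Poissonized and X not. The two steps cost
    [g / r + L] and [h1 / r + L]; since [h1 / r <= 2 * (g / r) + L], they add up to
    [3 * (g / r + L)]. *)
Lemma diff_entropy_gap (d N : nat) : (0 < d)%N -> (0 < N)%N ->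
  `|fine (pmf_entropy (@diff_pmf R d N N)) -
    d%:R * fine (srw_entropy (2 * N%:R / d%:R : R))| <=
  3 * (d%:R * ln (N + N).+1%:R / Num.sqrt N%:R + (ln (N%:R + 2) + 1)).
Proof.
move=> d0 N0; have s0 : 0 <= N%:R :> R by [].
have t0 : 0 <= N%:R / d%:R :> R by rewrite divr_ge0.
have pm := @point_mass_pmf R 'rV[int]_d.
pose u := @unit_step d; pose v := @neg_unit_step d.
have fin0 : (pmf_entropy (@point_mass R 'rV[int]_d) < +oo)%E.
  by rewrite point_mass_entropy.
have qE := @prod_srw_pmf R d d0 N%:R s0.
have [sp sf] := srw_pmf_entropy_fin t0.
have tE : 2 * N%:R / d%:R = 2 * (N%:R / d%:R) :> R by rewrite mulrA.
have dh : fine (pmf_entropy (pois u N%:R (pois v N%:R point_mass))) =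
    d%:R * fine (srw_entropy (2 * N%:R / d%:R : R)).
  rewrite -qE tE prod_row_entropy // fineM //.
  by rewrite ge0_fin_numE // pmf_entropy_ge0.
have p1 := pois_pmf d0 v s0 pm; have f1 := pois_entropy_fin d0 v s0 pm fin0.
have p2 := iter_avg_pmf d0 u N pm.
have f2 : (pmf_entropy (iter N (avg u) (@point_mass R _)) < +oo)%E.
  exact: le_lt_trans (diff_entropy_le d0 N 0) (ltry _).
have b1 := pois_entropy_bounds d0 u N0 p1 f1.
have b2 := pois_entropy_bounds d0 v N0 p2 f2.
rewrite dh iter_avg_pois // in b1; rewrite iter_avgC in b2.
move: b1 b2; rewrite -/(diff_pmf N N).
set g := fine (pmf_entropy (diff_pmf N N)); set h1 := fine (pmf_entropy (pois v _ _)).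
set h := d%:R * _; set L := ln _ + 1; set r := Num.sqrt _.
have g0 : 0 <= g by rewrite fine_ge0 // pmf_entropy_ge0 //; exact: diff_pmf_pmf.
have L0 : 0 <= L by rewrite addr_ge0 // ln_ge0 //; lra.
have NR : 1 <= N%:R :> R by rewrite ler1n.
have r1 : 1 <= r by rewrite -[1]sqrtr1 ler_wsqrtr.
have r0 : 0 < r by lra.
have g1 : g <= d%:R * ln (N + N).+1%:R.
  rewrite -lee_fin; apply: le_trans (diff_entropy_le d0 N N).
  by rewrite fineK // ge0_fin_numE ?pmf_entropy_ge0 //;
    [exact: le_lt_trans (diff_entropy_le d0 N N) (ltry _)|exact: diff_pmf_pmf].
have gr : g / r <= d%:R * ln (N + N).+1%:R / r by rewrite ler_pM2r ?invr_gt0.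
have i1 : r^-1 <= 1 by rewrite invf_le1.
have i0 : 0 < r^-1 by rewrite invr_gt0.
rewrite !ler_norml => /andP[a1 a2] /andP[a3 a4].
have gi : g / r <= g by rewrite ler_piMr.
have h1r : h1 / r <= 2 * (g / r) + L.
  have : h1 / r <= (2 * g + L) / r by rewrite ler_pM2r ?invr_gt0 //; lra.
  have : L / r <= L by rewrite ler_piMr.
  lra.
apply/andP; split; lra.
Qed.

(** * From the explicit gap to the two asymptotic regimes *)

Lemma ln_le_root6 (x : R) : 0 < x -> ln x <= 6 * x `^ (1 / 6).
Proof.
move=> x0; have xp : 0 < x `^ (1 / 6) by rewrite powR_gt0.
have -> : ln x = 6 * ln (x `^ (1 / 6)) by rewrite ln_powR; field.
rewrite ler_pM2l //; have := @le_ln1Dx R (x `^ (1 / 6) - 1).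
by rewrite addrCA subrr addr0 ltrBDr addNr => /(_ xp); lra.
Qed.

(** For [N >= 3] both [2N + 1] and [N + 2] are at most [N^2]. Hence 36 is 3 times 12, from
    [ln (2N + 1) <= 2 ln N <= 12 N^(1/6)] and 1/6 - 1/2 = -1/3, while 9 is 3 times 3, from
    [2 ln N + 1 <= 3 ln N]. *)
Lemma entropy_gap_powers (d : R) (N : nat) : 0 <= d -> (3 <= N)%N -> expR 1 <= N%:R :> R ->
  3 * (d * ln (N + N).+1%:R / Num.sqrt N%:R + (ln (N%:R + 2) + 1)) <=
  36 * (d * N%:R `^ (- (1 / 3))) + 9 * ln (N%:R : R).
Proof.
move=> d0 N3 eN; have NR : 3 <= N%:R :> R by rewrite (ler_nat _ 3).
have N0 : 0 < N%:R :> R by lra.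
have l1 : 1 <= ln N%:R :> R by rewrite -[leLHS](@expRK R 1) ler_ln ?posrE ?expR_gt0.
have sq : ln (N%:R ^+ 2) = 2 * ln N%:R :> R by rewrite lnXn // mulr_natl.
have l2 : ln (N + N).+1%:R <= 2 * ln N%:R :> R.
  rewrite -sq ler_ln ?posrE ?exprn_gt0 //.
  have -> : (N + N).+1%:R = N%:R + N%:R + 1 :> R by rewrite -natr1 natrD.
  nra.
have l3 : ln (N%:R + 2) <= 2 * ln N%:R :> R.
  have N20 : 0 < N%:R + 2 :> R by lra.
  by rewrite -sq ler_ln ?posrE ?exprn_gt0 //; nra.
have l6 := ln_le_root6 N0.
have -> : N%:R `^ (- (1 / 3)) = N%:R `^ (1 / 6) / Num.sqrt N%:R :> R.
  rewrite -powR12_sqrt ?ltW // -powRN -powRD; last by apply/implyP => _; rewrite gt_eqF.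
  by congr (_ `^ _); field.
set r := Num.sqrt _; have r0 : 0 < r by rewrite sqrtr_gt0.
suff : d * ln (N + N).+1%:R / r <= 12 * (d * (N%:R `^ (1 / 6) / r)) by lra.
rewrite mulrA mulrCA [leRHS]mulrA ler_pM2r ?invr_gt0 //.
have l12 : ln (N + N).+1%:R <= 12 * N%:R `^ (1 / 6) :> R by lra.
have := ler_wpM2l d0 l12; lra.
Qed.

End EntropyGap.

Theorem proposition3p3 (R : realType) (d N : nat -> nat)
    (disp : nat -> measure_display)
    (Omega : forall n, measurableType (disp n))
    (P : forall n, probability (Omega n) R)
    (X Y : forall n, Omega n -> 'rV[int]_(d n)) :
  (fun=> 1 : R) =o_\oo (fun n => (d n)%:R : R) ->
  (fun n => (d n)%:R : R) =O_\oo (fun n => (N n)%:R : R) ->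
  (forall n, multinomial_rv (P n) (N n) (uniform_param R (d n)) (X n)) ->
  (forall n, multinomial_rv (P n) (N n) (uniform_param R (d n)) (Y n)) ->
  (forall n, independent_rv (P n) (X n) (Y n)) ->
  exists E : nat -> R,
    [/\ forall n, rv_entropy (P n) (fun w => X n w - Y n w) =
          ((d n)%:R%:E * srw_entropy (2 * (N n)%:R / (d n)%:R : R) + (E n)%:E)%E,
        (fun n => (d n)%:R : R) =o_\oo (fun n => (N n)%:R : R) ->
        E =O_\oo (fun n =>
          Num.max (Num.max ((d n)%:R * (N n)%:R `^ (- (1 / 3)))
                           ((d n)%:R * ((N n)%:R / (d n)%:R) `^ (- (1 / 4))))
                  (ln (N n)%:R) : R) &
        (fun n => (N n)%:R : R) =O_\oo (fun n => (d n)%:R : R) ->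
        E =O_\oo (fun n => (N n)%:R `^ (2 / 3) : R)].
Proof.
move=> d_oo dN mX mY XY.
pose E n := fine (rv_entropy (P n) (fun w => X n w - Y n w)) -
  (d n)%:R * fine (srw_entropy (2 * (N n)%:R / (d n)%:R : R)).
exists E.
have hE n : rv_entropy (P n) (fun w => X n w - Y n w) =
    ((d n)%:R%:E * srw_entropy (2 * (N n)%:R / (d n)%:R : R) + (E n)%:E)%E.
  rewrite /E; have [d0|d0] := posnP (d n).
    have dn0 : (d n)%:R = 0 :> R by rewrite d0.
    have -> : rv_entropy (P n) (fun w => X n w - Y n w) = 0%E.
      rewrite /rv_entropy /pmf_entropy esum1 // => x _.
      rewrite /rv_pmf (_ : _ @^-1` _ = setT) ?probability_setT ?ln1 ?mulr0 ?oppr0 //.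
      by apply/seteqP; split => // w _ /=; apply/rowP => -[k kd]; exfalso; move: kd; rewrite d0.
    by rewrite dn0 mul0e mul0r subr0 add0e.
  have t0 : 0 <= (N n)%:R / (d n)%:R :> R by rewrite divr_ge0.
  have [sp sf] := srw_pmf_entropy_fin t0.
  rewrite /rv_entropy (rv_pmf_diff d0 (mX n) (mY n) (XY n)).
  have pf : (pmf_entropy (@diff_pmf R (d n) (N n) (N n)) < +oo)%E.
    exact: le_lt_trans (diff_entropy_le d0 _ _) (ltry _).
  rewrite -[pmf_entropy _ in LHS]fineK; last first.
    by rewrite ge0_fin_numE // pmf_entropy_ge0 //; exact: diff_pmf_pmf.
  rewrite -mulrA -[srw_entropy _ in RHS]fineK; last first.
    by rewrite ge0_fin_numE // pmf_entropy_ge0.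
  by rewrite -EFinM -EFinD addrC subrK.
have [C C0 dC] : exists2 C : R, 0 < C & \forall n \near \oo, (d n)%:R <= C * (N n)%:R :> R.
  have /eqO_exP[C C0 h] := dN; exists C => //.
  by near do rewrite -[leLHS]normr_nat -[(N _)%:R]normr_nat.
have d_ge (M : R) : \forall n \near \oo, M <= (d n)%:R.
  have /eqoP h := d_oo.
  have M0 : 0 < (`|M| + 1)^-1 by rewrite invr_gt0 ltr_wpDl.
  near=> n; have : `|1 : R| <= (`|M| + 1)^-1 * `|(d n)%:R : R| by near: n; exact: h.
  rewrite normr1 normr_nat ler_pdivlMl ?ltr_wpDl // mulr1.
  have := ler_norm M; lra.
have N_ge (M : R) : \forall n \near \oo, M <= (N n)%:R.
  near=> n.
  have h1 : C * M <= (d n)%:R by near: n; exact: d_ge.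
  have h2 : (d n)%:R <= C * (N n)%:R by near: n.
  by rewrite -(ler_pM2l C0) (le_trans h1).
have bound : \forall n \near \oo, `|E n| <=
    36 * ((d n)%:R * (N n)%:R `^ (- (1 / 3))) + 9 * ln (N n)%:R.
  near=> n.
  have d0 : (0 < d n)%N by rewrite -(ler1n R); near: n; exact: d_ge.
  have N3 : (3 <= N n)%N by rewrite -(ler_nat R); near: n; exact: N_ge.
  apply: le_trans (entropy_gap_powers (ler0n _ _) N3 _); last by near: n; exact: N_ge.
  rewrite /E /rv_entropy (rv_pmf_diff d0 (mX n) (mY n) (XY n)).
  by apply: diff_entropy_gap => //; exact: leq_trans N3.
split => // _.
(* 45 = 36 + 9: the terms [A] and [L] are each at most the maximum. *)
- apply/eqO_exP; exists 45 => //; near=> n.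
  have b : `|E n| <= 36 * ((d n)%:R * (N n)%:R `^ (- (1 / 3))) + 9 * ln (N n)%:R.
    by near: n.
  apply: (le_trans b); set A := _ * _ `^ _; set B := _ * _ `^ _; set L := ln _.
  apply: le_trans (ler_wpM2l _ (ler_norm _)) => //.
  have mA : A <= Num.max (Num.max A B) L by rewrite !le_max lexx.
  have mL : L <= Num.max (Num.max A B) L by rewrite !le_max lexx orbT.
  by lra.
(* [d <= C * N] turns [d N^(-1/3)] into [C N^(2/3)], and 54 is 9 times 6, from
   [ln N <= 6 N^(1/6) <= 6 N^(2/3)]. *)
- apply/eqO_exP; exists (36 * C + 54); first by rewrite addr_gt0 // mulr_gt0.
  near=> n.
  have b : `|E n| <= 36 * ((d n)%:R * (N n)%:R `^ (- (1 / 3))) + 9 * ln (N n)%:R.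
    by near: n.
  have h2 : (d n)%:R <= C * (N n)%:R by near: n.
  have N1 : 1 <= (N n)%:R :> R by near: n; exact: N_ge.
  have N0 : 0 < (N n)%:R :> R by lra.
  apply: (le_trans b); rewrite ger0_norm ?powR_ge0 //.
  have l : ln (N n)%:R <= 6 * (N n)%:R `^ (2 / 3) :> R.
    apply: (le_trans (ln_le_root6 N0)); rewrite ler_pM2l // ler_powR //; lra.
  have p : (d n)%:R * (N n)%:R `^ (- (1 / 3)) <= C * (N n)%:R `^ (2 / 3) :> R.
    apply: le_trans (ler_wpM2r (powR_ge0 _ _) h2) _.
    rewrite -mulrA ler_pM2l // -{1}(powRr1 (ltW N0)) -powRD; last first.
      by apply/implyP => _; rewrite gt_eqF.
    by rewrite le_eqVlt; apply/orP; left; apply/eqP; congr (_ `^ _); field.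
  by lra.
Unshelve. all: by end_near.
Qed.
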